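(* Let $\mathfrak B$ be a white noise over a separable Hilbert space $\mathbf H$ with orthonormal basis $\{m_k\}_{k\ge1}$, and let $\eta$ be $(\mathfrak B,\mathbf H)$-admissible with chaos expansion $\eta=\sum_{\alpha\in\mathcal I}\eta_\alpha\xi_\alpha$, $\eta_\alpha=\mathbb E(\eta\xi_\alpha)\in\mathbf H$, and assume that $$\eta_\alpha=\sum_{k=1}^\infty\eta_{\alpha,k}\,m_k .$$ Then the Itô stochastic integral of $\eta$ has the (formal) chaos expansion $$\mathfrak B^{\diamond}(\eta)=\sum_{\alpha\in\mathcal I}\left(\sum_{k=1}^\infty\sqrt{\alpha_k}\,\eta_{\alpha-\epsilon_k,k}\right)\xi_\alpha,$$ and the Stratonovich stochastic integral of $\eta$ has the (formal) chaos expansion $$\mathfrak B^{\circ}(\eta)=\sum_{\alpha\in\mathcal I}\left(\sum_{k=1}^\infty\Big(\sqrt{\alpha_k}\,\eta_{\alpha-\epsilon_k,k}+\sqrt{\alpha_k+1}\,\eta_{\alpha+\epsilon_k,k}\Big)\right)\xi_\alpha .$$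
   Context: All Hilbert spaces are real. A white noise over $\mathbf H$ is a linear map $f\mapsto\mathfrak B(f)$ from $\mathbf H$ to zero-mean Gaussian random variables with $\mathbb E(\mathfrak B(f)\mathfrak B(g))=(f,g)_{\mathbf H}$. $\mathcal F^{\mathfrak B}$ is the sigma-algebra generated by $\{\mathfrak B(f):f\in\mathbf H\}$ and $\mathbb H_{\mathfrak B}$ is the Hilbert space of square integrable $\mathcal F^{\mathfrak B}$-measurable random variables. $\mathcal I$ is the set of multi-indices $\alpha=(\alpha_1,\alpha_2,\dots)$ of non-negative integers with $|\alpha|=\sum_k\alpha_k<\infty$; $\alpha!=\prod_k\alpha_k!$; $\epsilon_k$ is the multi-index with $1$ in position $k$ and $0$ elsewhere. $H_n(t)=(-1)^ne^{t^2/2}\frac{d^n}{dt^n}e^{-t^2/2}$ are the Hermite polynomials; $\xi_k=\mathfrak B(m_k)$ and $\xi_\alpha=\prod_kH_{\alpha_k}(\xi_k)/\sqrt{\alpha_k!}$. The family $\{\xi_\alpha\}_{\alpha\in\mathcal I}$ is an orthonormal basis of $\mathbb H_{\mathfrak B}$. The Wick product $\diamond$ is the bilinear operation determined by $\xi_\alpha\diamond\xi_\beta=\sqrt{(\alpha+\beta)!/(\alpha!\beta!)}\,\xi_{\alpha+\beta}$, extended to series in $\xi_\alpha$, $\xi_\beta$ term by term. An $\mathbf H$-valued random element $\eta$ is $(\mathfrak B,\mathbf H)$-admissible if $\mathbb E\|\eta\|_{\mathbf H}^2<\infty$ and, for every $f\in\mathbf H$, the random variable $(\eta,f)_{\mathbf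 H}$ is $\mathcal F^{\mathfrak B}$-measurable. The Itô and Stratonovich stochastic integrals of such $\eta$ are $$\mathfrak B^\diamond(\eta)=\sum_{\alpha\in\mathcal I}\mathfrak B(\eta_\alpha)\diamond\xi_\alpha,\qquad \mathfrak B^\circ(\eta)=\sum_{\alpha\in\mathcal I}\mathfrak B(\eta_\alpha)\cdot\xi_\alpha ,$$ with $\cdot$ the usual product. Terms $\sqrt{\alpha_k}\,\eta_{\alpha-\epsilon_k,k}$ with $\alpha_k=0$ are zero. No convergence of the series over $\alpha$ (nor of the inner series in the Stratonovich case) is asserted; the equalities are between formal series: each term $\mathfrak B(\eta_\beta)\diamond\xi_\beta$ (respectively $\mathfrak B(\eta_\beta)\cdot\xi_\beta$) is an element of $\mathbb H_{\mathfrak B}$, is expanded in the basis $\{\xi_\alpha\}$, and the coefficients of each $\xi_\alpha$ are collected over all $\beta\in\mathcal I$ (as a formal sum). *)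

(* Defs.v *)
From HB Require Import structures.
From mathcomp Require Import all_boot all_order all_algebra finmap.
From mathcomp Require Import all_classical all_reals all_analysis.

Set Implicit Arguments.
Unset Strict Implicit.
Unset Printing Implicit Defensive.

Import Order.TTheory GRing.Theory Num.Theory.
Import numFieldNormedType.Exports.

Local Open Scope classical_set_scope.
Local Open Scope ring_scope.

(* Sequences are indexed from 0: the index k : nat stands for k + 1 >= 1. *)

Definition multiindex := {fsfun nat -> nat with 0%N}.

Definition mi_unit (k : nat) : multiindex :=
  [fsfun i in [fset k]%fset => 1%N | 0%N].

Definition mi_add (a b : multiindex) : multiindex :=
  [fsfun k in (finsupp a `|` finsupp b)%fset => (a k + b k)%N | 0%N].

(* Truncated subtraction: alpha - epsilon_k is a junk value when
   alpha_k = 0, where it only ever occurs with the factor sqrt alpha_k = 0. *)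
Definition mi_sub (a b : multiindex) : multiindex :=
  [fsfun k in finsupp a => (a k - b k)%N | 0%N].

Definition mi_fact (a : multiindex) : nat := (\prod_(k <- finsupp a) (a k)`!)%N.

Lemma mi_unitE k i : mi_unit k i = (i == k) :> nat.
Proof. by rewrite fsfunE inE; case: eqP. Qed.

Lemma mi_addE a b k : mi_add a b k = (a k + b k)%N.
Proof.
by rewrite fsfunE in_fsetU; case: (finsuppP a) => //=; case: (finsuppP b).
Qed.

Lemma mi_subE a b k : mi_sub a b k = (a k - b k)%N.
Proof. by rewrite fsfunE; case: finsuppP. Qed.

(* A formal sum is a family of terms without prescribed order; no
   convergence is involved. *)
Record formal_sum (V : Type) := FormalSum {
  fs_index : Type;
  fs_term : fs_index -> V }.

Definition fs_one V (x : V) : formal_sum V := FormalSum (fun _ : unit => x).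

Definition fs_add V (F G : formal_sum V) : formal_sum V :=
  FormalSum (fun i : fs_index F + fs_index G =>
    match i with inl j => fs_term j | inr j => fs_term j end).

Definition fs_series V (I : Type) (F : I -> formal_sum V) : formal_sum V :=
  FormalSum (fun i : {i : I & fs_index (F i)} => fs_term (projT2 i)).

(* Equality of formal sums up to order, bracketing and null terms: every
   nonzero value occurs the same number (possibly infinite) of times. *)
Definition fs_eq (V : nmodType) (F G : formal_sum V) : Prop :=
  forall x : V, x != 0 ->
    ([set i | @fs_term V F i = x] #= [set j | @fs_term V G j = x])%card.

Section hilbert.
Context (R : realType) (H : completeNormedModType R) (dot : {dot H for idfun}).

Definition hilbert_norm := forall x : H, dot x x = `|x| ^+ 2.

Definition separable := exists D : set H, countable D /\ dense D.

Definition orthonormal_basis (m : nat -> H) :=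
  (forall i j, dot (m i) (m j) = (i == j)%:R) /\
  (forall f : H, (fun n => \sum_(0 <= k < n) dot f (m k) *: m k) @ \oo --> f).

End hilbert.

Section white_noise.
Context (d : measure_display) (T : measurableType d) (R : realType)
  (P : probability T R).

(* The degenerate case is separate because normal_prob 0 0 is not a Dirac
   mass but the uniform law on [0, 1]. *)
Definition centered_gaussian (X : {RV P >-> R}) :=
  exists s : R, 0 <= s /\
    forall A : set R, measurable A ->
      distribution P X A = if s == 0 then \d_(0 : R) A else normal_prob 0 s A.

Context (H : completeNormedModType R) (dot : {dot H for idfun}).

Record white_noise (B : H -> {RV P >-> R}) : Prop := WhiteNoise {
  wn_linear : forall (a : R) (f g : H),
    {ae P, forall w, B (a *: f + g) w = a * B f w + B g w};
  wn_gaussian : forall f : H, centered_gaussian (B f);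
  wn_covariance : forall f g : H,
    ('E_P[fun w => (B f w * B g w)%R] = (dot f g)%:E)%E }.

Variables (B : H -> {RV P >-> R}) (m : nat -> H).

Definition sigma_noise : set (set T) :=
  <<s [set S | exists f : H, exists2 A : set R,
                 measurable A & S = B f @^-1` A] >>.

Definition noise_measurable (X : T -> R) :=
  forall A : set R, measurable A -> sigma_noise (X @^-1` A).

Definition noise_L2 (X : T -> R) :=
  noise_measurable X /\ ('E_P[fun w => (X w ^+ 2)%R] < +oo)%E.

Definition hermite (n : nat) (t : R) : R :=
  (-1) ^+ n * expR (t ^+ 2 / 2) *
    derive1n n (fun s : R => expR (- (s ^+ 2 / 2))) t.

(* The factors with alpha_k = 0 are all equal to 1. *)
Definition xi (a : multiindex) (w : T) : R :=
  \prod_(k <- finsupp a) (hermite (a k) (B (m k) w) / Num.sqrt (a k)`!%:R).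

Definition chaos_coef (X : T -> R) (a : multiindex) : R :=
  fine ('E_P[fun w => (X w * xi a w)%R])%E.

(* Coefficient of xi_c in the product of sum_a X_a xi_a and sum_b Y_b xi_b;
   the sum ranges over a finite set of pairs. *)
Definition wick_coef (X Y : T -> R) (c : multiindex) : R :=
  \sum_(p \in [set p : multiindex * multiindex | mi_add p.1 p.2 = c])
    chaos_coef X p.1 * chaos_coef Y p.2 *
    Num.sqrt ((mi_fact c)%:R / (mi_fact p.1 * mi_fact p.2)%:R).

Definition is_wick_product (X Y Z : T -> R) :=
  noise_L2 Z /\ forall c, chaos_coef Z c = wick_coef X Y c.

Record admissible (eta : T -> H) : Prop := Admissible {
  adm_random_element : forall U : set H, open U -> measurable (eta @^-1` U);
  adm_square_integrable : ('E_P[fun w => (`|eta w| ^+ 2)%R] < +oo)%E;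
  adm_measurable : forall f : H, noise_measurable (fun w => dot (eta w) f) }.

(* E(Y) = v weakly; it is the Bochner expectation when H is separable and Y
   is integrable. *)
Definition is_expectation (Y : T -> H) (v : H) :=
  forall f : H, ('E_P[fun w => dot (Y w) f] = (dot v f)%:E)%E.

(* A formal series sum_b U_b in the space of square integrable functionals
   of the noise has the formal expansion sum_a (c_a) xi_a: each U_b is
   expanded in the basis, and the coefficients of xi_a are collected over
   all b. *)
Definition formal_chaos_expansion (U : multiindex -> T -> R)
    (c : multiindex -> formal_sum R) :=
  (forall b, noise_L2 (U b)) /\
  forall a, fs_eq (fs_series (fun b => fs_one (chaos_coef (U b) a))) (c a).

Definition ito_integral (etaA : multiindex -> H) (U : multiindex -> T -> R) :=
  forall b, is_wick_product (B (etaA b)) (xi b) (U b).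

Definition stratonovich_integral (etaA : multiindex -> H) :
    multiindex -> T -> R :=
  fun b w => B (etaA b) w * xi b w.

End white_noise.

(* Main.v *)
Require Import Defs.
From HB Require Import structures.
From mathcomp Require Import all_boot all_order all_algebra finmap.
From mathcomp Require Import all_classical all_reals all_analysis.
From mathcomp Require Import measurable_realfun.
From mathcomp Require Import ring lra.

Set Implicit Arguments.
Unset Strict Implicit.
Unset Printing Implicit Defensive.

Import Order.TTheory GRing.Theory Num.Theory.
Import numFieldNormedType.Exports.

Local Open Scope classical_set_scope.
Local Open Scope ring_scope.

(** Everything comes from one computation: for f in the Hilbert space, the
    coefficient of xi_a in the ordinary product B(f) xi_b. With e_k the unit
    multi-indices, it is sqrt(a_k) (f, m_k) if a = b + e_k, it is
    sqrt(b_k) (f, m_k) if b = a + e_k, and it vanishes otherwise (lemmas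
    chaos_coef_mulB_xi_up, chaos_coef_mulB_xi_down, chaos_coef_mulB_xi_neq0).

    This is an instance of Gaussian integration by parts,
      E[B(f) X] = E[D_f X],
    for X a polynomial in the noise and D_f its derivative in the direction f,
    with D_f B(u) = (f, u) (lemma gaussian_by_parts). By H_n' = n H_(n-1), the
    derivative lowers multi-indices: D_f xi_a is the sum over k of
    (f, m_k) sqrt(a_k) xi_(a - e_k). Applied to f = m_k and X = xi_a xi_b,
    integration by parts first gives the orthonormality of the xi_a (lemma
    mean_xi_xi), by removing units from a and b in parallel. Applied to a
    general f, it then gives the coefficient above.

    Integration by parts for the noise rests on the one-dimensional recursion
    E[Z^(n+1)] = n v E[Z^(n-1)] for the moments of a centered Gaussian variable
    Z of variance v, which is an integration by parts on the line. For
    Z = B(u + t f) both sides are polynomials in t, because B is linear almost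
    surely and the covariance is the inner product. Comparing the coefficients
    of t yields E[B(f) B(u)^n] = n (f, u) E[B(u)^(n-1)]. Comparing coefficients
    again, with u replaced by u + t v, polarizes this into the formula for
    arbitrary monomials, one factor at a time.

    In the Wick product of B(f) and xi_b only the multi-indices b + e_k remain.
    It is therefore B(f) xi_b minus the finitely many terms with b - e_k, which
    is an explicit polynomial in the noise (lemma is_wick_productB_xi).

    To compare the formal series, fix a. The term of index b contributes to the
    coefficient of xi_a only if b = a - e_k or b = a + e_k for some k. These
    multi-indices are pairwise distinct, so the nonzero contributions are in
    bijection with the nonzero terms of the stated expansions. The inner
    product (eta_b, m_k) equals eta_(b,k), because the inner product with m_k
    is continuous (lemma dot_series). *)

(** * Moments of the normal law *)

Section normal_moments.
Variable R : realType.
Implicit Types (s x : R) (n : nat).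
Notation mu := (@lebesgue_measure R).

(** The density is almost everywhere equal to the Radon-Nikodym derivative of the
    law, as both have the same integral on every measurable set. *)
Lemma ge0_integral_normal_prob s (f : R -> R) : s != 0 ->
  measurable_fun setT f -> (forall x, 0 <= f x) ->
  (\int[normal_prob 0 s]_x (f x)%:E =
   \int[mu]_x (f x * normal_pdf 0 s x)%:E)%E.
Proof.
move=> s0 mf f0.
have dom := @normal_prob_dominates R 0 s.
rewrite -(Radon_Nikodym_SigmaFinite.change_of_variables dom)//; last exact/measurable_EFinP.
have irn := Radon_Nikodym_SigmaFinite.f_integrable dom.
have mpdf : measurable_fun setT (EFin \o normal_pdf 0 s).
  by apply/measurable_EFinP; exact: measurable_normal_pdf.
under [RHS]eq_integral do rewrite EFinM.
apply: ae_eq_integral => //.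
- apply: emeasurable_funM; first exact/measurable_EFinP.
  exact: (measurable_int mu irn).
- by apply: emeasurable_funM => //; exact/measurable_EFinP.
- apply: ae_eqe_mul2l; apply: integral_ae_eq => //.
  by move=> E _ mE; rewrite -Radon_Nikodym_SigmaFinite.f_integral.
Qed.

Lemma integrable_normal_prob s (f : R -> R) : s != 0 ->
  measurable_fun setT f ->
  mu.-integrable setT (fun x => (f x * normal_pdf 0 s x)%:E) ->
  (normal_prob 0 s).-integrable setT (EFin \o f).
Proof.
move=> s0 mf /integrableP[_ fi]; apply/integrableP; split.
  exact/measurable_EFinP.
apply: le_lt_trans fi.
rewrite ge0_integral_normal_prob//; last exact: measurableT_comp.
by under [X in (_ <= X)%E]eq_integral do
  rewrite /= normrM (ger0_norm (normal_pdf_ge0 _ _ _)).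
Qed.

Lemma integral_normal_prob s (f : R -> R) : s != 0 ->
  measurable_fun setT f ->
  mu.-integrable setT (fun x => (f x * normal_pdf 0 s x)%:E) ->
  (\int[normal_prob 0 s]_x (f x)%:E =
   \int[mu]_x (f x * normal_pdf 0 s x)%:E)%E.
Proof.
move=> s0 mf fi.
rewrite [LHS]integralE [RHS]integralE; congr (_ - _)%E.
  transitivity (\int[normal_prob 0 s]_x (f^\+%R x)%:E)%E.
    by apply: eq_integral => x _; rewrite funeposE /funrpos EFin_max.
  rewrite ge0_integral_normal_prob//; last exact: measurable_funrpos.
  apply: eq_integral => x _; rewrite funeposE /funrpos /=.
  by rewrite -EFin_max maxr_pMl ?mul0r// normal_pdf_ge0.
transitivity (\int[normal_prob 0 s]_x (f^\-%R x)%:E)%E.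
  by apply: eq_integral => x _; rewrite funenegE /funrneg EFin_max.
rewrite ge0_integral_normal_prob//; last exact: measurable_funrneg.
apply: eq_integral => x _; rewrite funenegE /funrneg /=.
by rewrite -EFin_max maxr_pMl ?mul0r ?mulNr// normal_pdf_ge0.
Qed.

Lemma exprn_expR_bound n : exists C : R, forall x,
  `|x| ^+ n <= C * expR (x ^+ 2).
Proof.
exists (1 + n`!%:R) => x.
have e1 : 1 <= expR (x ^+ 2) by rewrite -expR0 ler_expR sqr_ge0.
have f0 : 0 < n`!%:R :> R by rewrite ltr0n fact_gt0.
case: (leP `|x| 1) => [x1|/ltW x1].
  apply: le_trans (exprn_ile1 _ (normr_ge0 x) x1) _.
  by rewrite mulrDl mul1r (le_trans e1)// lerDl mulr_ge0 ?expR_ge0 ?ltW.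
apply: (@le_trans _ _ (n`!%:R * expR (x ^+ 2))); last first.
  by rewrite mulrDl mul1r lerDr expR_ge0.
apply: (@le_trans _ _ ((x ^+ 2) ^+ n)).
  by rewrite -real_normK ?num_real// -exprM ler_weXn2l// leq_pmull.
case: n f0 => [|n] f0; first by rewrite expr0 fact0 mul1r.
rewrite mulrC -ler_pdivrMr//.
apply: (le_trans _ (expR_ge1Dxn n (sqr_ge0 x))).
by rewrite lerDr ler01.
Qed.

(** Doubling the standard deviation leaves room in the exponential for any power
    of x. This gives the integrability of the powers, and also the decay of the
    boundary terms in the integration by parts below. *)
Lemma exprn_normal_pdf_bound s n : s != 0 -> exists C, forall x,
  `|x ^+ n * normal_pdf 0 s x| <= C * normal_pdf 0 (2 * s) x.
Proof.
move=> s0.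
have t0 : 2 * s != 0 by rewrite mulf_neq0// pnatr_eq0.
have [C CP] := exprn_expR_bound n.
have C0 : 0 <= C.
  by have := le_trans (exprn_ge0 n (normr_ge0 0)) (CP 0); rewrite expr0n expR0 mulr1.
have p1 := normal_peak_gt0 s0; have p2 := normal_peak_gt0 t0.
exists (`|2 * s| ^+ n * C * normal_peak s / normal_peak (2 * s)) => x.
rewrite normrM (ger0_norm (normal_pdf_ge0 _ _ _)) normrX.
rewrite !normal_pdfE//= [leRHS]mulrA mulfVK ?gt_eqF//.
rewrite mulrCA [leRHS]mulrAC [leRHS]mulrC ler_wpM2l ?(ltW p1)//.
have -> : x = (2 * s) * (x / (2 * s)) by rewrite mulrC divfK.
set y := x / (2 * s).
set f := normal_fun 0 s _; set g := normal_fun 0 _ _.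
rewrite normrM exprMn -!mulrA ler_wpM2l ?exprn_ge0//.
apply: le_trans (ler_wpM2r (normal_fun_ge0 _ _ _) (CP y)) _.
(* with y = x / (2 s), the exponents compare as y^2 - 2 y^2 <= - y^2 / 2 *)
rewrite -(mulrA C) ler_wpM2l// /f /g /normal_fun -expRD ler_expR !subr0.
have -> : - (2 * s * y) ^+ 2 / (s ^+ 2 *+ 2) = - (2 * y ^+ 2) by field.
have -> : - (2 * s * y) ^+ 2 / ((2 * s) ^+ 2 *+ 2) = - (y ^+ 2 / 2) by field.
by have := sqr_ge0 y; lra.
Qed.

Lemma integrable_exprn_normal_pdf s n : s != 0 ->
  mu.-integrable setT (fun x => (x ^+ n * normal_pdf 0 s x)%:E).
Proof.
move=> s0; have [C CP] := exprn_normal_pdf_bound n s0.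
apply: (@le_integrable _ _ _ mu setT measurableT _
  (fun x => C%:E * (normal_pdf 0 (2 * s) x)%:E)%E) => //.
- apply/measurable_EFinP; apply: measurable_funM; first exact: exprn_measurable.
  exact: measurable_normal_pdf.
- by move=> x _; rewrite -EFinM lee_fin; apply: le_trans (CP x) (ler_norm _).
- by apply: integrableZl => //; exact: integrable_normal_pdf.
Qed.

Lemma is_derive_normal_pdf s x : s != 0 ->
  is_derive x 1 (normal_pdf 0 s) (- x / s ^+ 2 * normal_pdf 0 s x).
Proof.
move=> s0; rewrite normal_pdfE//.
have h : is_derive x 1 (fun y : R => - (y - 0) ^+ 2 / (s ^+ 2 *+ 2)) (- x / s ^+ 2).
  under eq_fun do rewrite subr0.
  have -> : (fun y : R => - y ^+ 2 / (s ^+ 2 *+ 2)) = (- (s ^+ 2 *+ 2)^-1) *: (id ^+ 2 : R -> R).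
    by apply/funext => y; rewrite !fctE /GRing.scale /=; ring.
  apply: is_derive_eq; rewrite /= /GRing.scale /= expr1 mulr1.
  by field.
have -> : (fun x => normal_peak s * normal_fun 0 s x) =
  normal_peak s *: (expR \o (fun y : R => - (y - 0) ^+ 2 / (s ^+ 2 *+ 2))).
  by [].
apply: is_derive_eq; rewrite /= /GRing.scale /= /normal_fun; ring.
Qed.

(** The derivative of x^n times the density is n x^(n-1) - x^(n+1) / s^2 times the
    density, and its integral over the line is zero. For n = 0 the exponent n.-1
    is harmless because of the factor n. *)
Lemma integral_exprS_normal_pdf s n : s != 0 ->
  (\int[mu]_x (x ^+ n.+1 * normal_pdf 0 s x)%:E =
   (n%:R * s ^+ 2)%:E * \int[mu]_x (x ^+ n.-1 * normal_pdf 0 s x)%:E)%E.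
Proof.
move=> s0.
pose F (x : R) := x ^+ n * normal_pdf 0 s x.
pose G (x : R) := n%:R * (x ^+ n.-1 * normal_pdf 0 s x)
   + - (s ^+ 2)^-1 * (x ^+ n.+1 * normal_pdf 0 s x).
have FG (x : R) : is_derive x 1 F (G x).
  have h := is_derive_normal_pdf x s0.
  have -> : F = (id ^+ n : R -> R) * normal_pdf 0 s.
    by apply/funext => y; rewrite /F !fctE.
  apply: is_derive_eq; rewrite /G !fctE /GRing.scale /=.
  by rewrite (exprS x n); ring.
have iG : mu.-integrable setT (EFin \o G).
  rewrite /G /comp; under eq_fun do rewrite EFinD 2!EFinM [X in (_ + X)%E]EFinM.
  apply: integrableD => //; apply: integrableZl => //;
    exact: integrable_exprn_normal_pdf.
suff : (\int[mu]_x (G x)%:E = 0)%E.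
  rewrite /G; under eq_integral do rewrite EFinD 2!EFinM [X in (_ + X)%E]EFinM.
  have i1 := integrable_exprn_normal_pdf n.-1 s0.
  have i2 := integrable_exprn_normal_pdf n.+1 s0.
  rewrite integralD//=; [|exact: integrableZl..].
  rewrite integralZl// integralZl//.
  have f1 := integrable_fin_num measurableT i1.
  have f2 := integrable_fin_num measurableT i2.
  rewrite -(fineK f1) -(fineK f2) -!EFinM -EFinD.
  case=> e; congr EFin; move: e; set a := fine _; set b := fine _ => e.
  have -> : b = s ^+ 2 * (s ^- 2 * b) by rewrite mulrA divff ?mul1r// expf_neq0.
  have -> : s ^- 2 * b = n%:R * a by lra.
  by ring.
(* bounding x F(x), and not F(x), gives the decay of F at infinity *)
have [C CP] := exprn_normal_pdf_bound n.+1 s0.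
pose f_ k x := (G x * \1_`[- k.+1%:R, k.+1%:R] x)%:E.
have cv1 : (\int[mu]_x f_ k x @[k --> \oo] --> \int[mu]_x (G x)%:E)%E.
  apply: (@dominated_cvg _ _ _ mu setT measurableT f_ _ (fun x => `|G x|%:E)) => //.
  - move=> k; apply/measurable_EFinP; apply: measurable_funM => //.
    by apply/measurable_EFinP; exact: (measurable_int mu iG).
  - move=> x _; apply: cvg_near_cst; exists (Num.bound `|x|) => // k /= xk.
    rewrite /f_ indicE mem_set ?mulr1//= in_itv/= -ler_norml.
    apply: ltW; apply: lt_le_trans (archi_boundP (normr_ge0 x)) _.
    by rewrite ler_nat leqW.
  - exact: integrable_abse iG.
  - move=> k x _; rewrite lee_fin normrM indicE.
    by case: (_ \in _); rewrite ?normr1 ?mulr1 ?normr0 ?mulr0.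
have cF : continuous F.
  by move=> x; apply: differentiable_continuous; apply/derivable1_diffP; case: (FG x).
have cG : continuous G.
  move=> x; apply: cvgD; (apply: cvgM; first exact: cvg_cst);
    apply: cvgM; [exact: exprn_continuous|exact: continuous_normal_pdf|
                  exact: exprn_continuous|exact: continuous_normal_pdf].
have FTC k : (\int[mu]_x f_ k x = (F k.+1%:R - F (- k.+1%:R))%:E)%E.
  have k0 : 0 < k.+1%:R :> R by rewrite ltr0n.
  rewrite EFinB -(@continuous_FTC2 _ G F).
  - rewrite [RHS]integral_mkcond; apply: eq_integral => x _.
    by rewrite /f_ EFinM epatch_indic.
  - lra.
  - exact: continuous_subspaceT.
  - split.
    + by move=> x _; case: (FG x).
    + by apply: cvg_at_right_filter; exact: cF.
    + by apply: cvg_at_left_filter; exact: cF.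
  - by move=> x _; rewrite derive1E; case: (FG x).
have cv2 : (\int[mu]_x f_ k x @[k --> \oo] --> 0)%E.
  under eq_fun do rewrite FTC.
  apply: cvg_EFin; first exact: nearW.
  pose K := 2 * (C * normal_peak (2 * s)).
  have hK : (fun k => K * harmonic k) @ \oo --> (0 : R).
    by rewrite -[0](mulr0 K); apply: cvgM; [exact: cvg_cst|exact: cvg_harmonic].
  have t0 : 2 * s != 0 by rewrite mulf_neq0// pnatr_eq0.
  have C0 : 0 <= C.
    have := le_trans (normr_ge0 _) (CP 0); rewrite pmulr_lge0//.
    by rewrite normal_pdfE//= mulr_gt0 ?normal_peak_gt0// expR_gt0.
  have FK x : 1 <= `|x| -> `|F x| <= C * normal_peak (2 * s) / `|x|.
    move=> x1; have x0 : 0 < `|x| by apply: lt_le_trans x1.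
    rewrite ler_pdivlMr// -normrM /F mulrAC -exprSr.
    by apply: le_trans (CP x) _; rewrite ler_wpM2l// normal_pdf_ub.
  apply: (@squeeze_cvgr _ _ _ _ (fun k => - (K * harmonic k)) (fun k => K * harmonic k)).
  - near=> k => /=; rewrite -ler_norml.
    have k1 : 1 <= k.+1%:R :> R by rewrite ler1n.
    have a1 := FK k.+1%:R; have a2 := FK (- k.+1%:R).
    rewrite normrN (ger0_norm (ler0n _ _)) in a2.
    rewrite (ger0_norm (ler0n _ _)) in a1.
    apply: le_trans (ler_normB _ _) _.
    apply: le_trans (lerD (a1 k1) (a2 k1)) _.
    by rewrite le_eqVlt /K /harmonic; apply/orP; left; apply/eqP; ring.
  - by rewrite -oppr0; exact: cvgN.
  - exact: hK.
by apply: cvg_unique cv1 cv2.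
Unshelve. all: by end_near.
Qed.

End normal_moments.

(** * Random variables with all moments, and the moments of the noise *)

Section transfer.
Context d (T : measurableType d) (R : realType) (P : probability T R).

Lemma integral_law d' (T' : measurableType d') (X : {RV P >-> T'})
    (nu : probability T' R) (f : T' -> R) :
  (forall A : set T', measurable A -> distribution P X A = nu A) ->
  measurable_fun setT f -> nu.-integrable setT (EFin \o f) ->
  P.-integrable setT (EFin \o (f \o X)) /\
  (\int[P]_w (f (X w))%:E = \int[nu]_x (f x)%:E)%E.
Proof.
move=> Xnu mf /integrableP[mEf fi].
have iX : P.-integrable setT (EFin \o (f \o X)).
  apply/integrableP; split.
    apply/measurable_EFinP; exact: measurableT_comp.
  apply: le_lt_trans fi.
  rewrite [leRHS](eq_measure_integral (distribution P X)); last by move=> A mA _; apply/esym/Xnu.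
  rewrite ge0_integral_distribution//.
  exact: measurableT_comp.
split=> //; rewrite [RHS](eq_measure_integral (distribution P X)); last first.
  by move=> A mA _; apply/esym/Xnu.
by rewrite integral_distribution.
Qed.

(** From 2 |a b| <= a^2 + b^2. Since only powers of X and of Y appear in the
    hypotheses, this makes the existence of all moments stable under products
    and, by the binomial formula, under sums. *)
Lemma integrableXM (X Y : T -> R) i j :
  measurable_fun setT X -> measurable_fun setT Y ->
  P.-integrable setT (fun w => (X w ^+ i.*2)%:E) ->
  P.-integrable setT (fun w => (Y w ^+ j.*2)%:E) ->
  P.-integrable setT (fun w => (X w ^+ i * Y w ^+ j)%:E).
Proof.
move=> mX mY iX iY.
apply: (@le_integrable _ _ _ P setT measurableT _
  (fun w => (X w ^+ i.*2)%:E + (Y w ^+ j.*2)%:E)%E) => //.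
- apply/measurable_EFinP; apply: measurable_funM; exact: measurable_funX.
- move=> w _; rewrite -EFinD lee_fin.
  rewrite -!muln2 !exprM; set a := _ ^+ i; set b := _ ^+ j.
  rewrite (ger0_norm (addr_ge0 (sqr_ge0 a) (sqr_ge0 b))) ler_norml.
  have := sqr_ge0 (a + b); have := sqr_ge0 (a - b).
  by move=> *; apply/andP; split; nra.
- exact: integrableD.
Qed.

End transfer.

Section moments.
Context d (T : measurableType d) (R : realType) (P : probability T R).
Context (H : completeNormedModType R) (dot : {dot H for idfun}).
Variables (B : H -> {RV P >-> R}).

(** Unlike square integrability, the existence of all moments is stable under
    products, so that integrability comes for free for every polynomial in the
    noise. *)
Definition has_moments (X : T -> R) :=
  noise_measurable B X /\
  forall n, P.-integrable setT (fun w => (X w ^+ n)%:E).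

Definition mean (X : T -> R) : R := fine ('E_P[X])%E.

Let G : set (set T) := [set S | exists f : H, exists2 A : set R,
                 measurable A & S = B f @^-1` A].

Lemma noise_measurableP (X : T -> R) : noise_measurable B X <->
  measurable_fun setT (X : g_sigma_algebraType G -> R).
Proof.
split=> mX; first by move=> _ A mA; rewrite setTI; exact: mX.
by move=> A mA; rewrite -[_ @^-1` _]setTI; apply: mX.
Qed.

Lemma noise_measurable_measurable (X : T -> R) :
  noise_measurable B X -> measurable_fun setT X.
Proof.
move=> mX _ A mA; rewrite setTI.
have := mX A mA; apply: smallest_sub.
  by split; [exact: measurable0|move=> ? ?; rewrite setTD; exact: measurableC|
             move=> ? ?; exact: bigcup_measurable].
by move=> _ [f [C mC ->]]; rewrite -[_ @^-1` _]setTI; exact: measurable_funP.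
Qed.

Lemma noise_measurableB f : noise_measurable B (B f).
Proof. by move=> A mA; apply: sub_sigma_algebra; exists f, A. Qed.

Lemma noise_measurable_cst c : noise_measurable B (fun=> c).
Proof. by apply/noise_measurableP; exact: measurable_cst. Qed.

Lemma noise_measurableD X Y : noise_measurable B X -> noise_measurable B Y ->
  noise_measurable B (fun w => X w + Y w).
Proof.
move=> /noise_measurableP mX /noise_measurableP mY; apply/noise_measurableP.
exact: measurable_funD.
Qed.

Lemma noise_measurableM X Y : noise_measurable B X -> noise_measurable B Y ->
  noise_measurable B (fun w => X w * Y w).
Proof.
move=> /noise_measurableP mX /noise_measurableP mY; apply/noise_measurableP.
exact: measurable_funM.
Qed.

Lemma has_moments_meas X : has_moments X -> measurable_fun setT X.
Proof. by case=> /noise_measurable_measurable. Qed.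

Lemma integrable_has_moments X : has_moments X ->
  P.-integrable setT (EFin \o X).
Proof. by case=> _ /(_ 1). Qed.

Lemma has_momentsXM X Y i j : has_moments X -> has_moments Y ->
  P.-integrable setT (fun w => (X w ^+ i * Y w ^+ j)%:E).
Proof.
move=> hX hY; apply: integrableXM; try exact: has_moments_meas.
  by case: hX. by case: hY.
Qed.

Lemma has_moments_cst c : has_moments (fun=> c).
Proof.
split; first exact: noise_measurable_cst.
by move=> n; apply: finite_measure_integrable_cst.
Qed.

Lemma has_momentsM X Y : has_moments X -> has_moments Y ->
  has_moments (fun w => X w * Y w).
Proof.
move=> hX hY; split; first by apply: noise_measurableM; [case: hX|case: hY].
by move=> n; under eq_fun do rewrite exprMn; exact: has_momentsXM.
Qed.

Lemma has_momentsD X Y : has_moments X -> has_moments Y ->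
  has_moments (fun w => X w + Y w).
Proof.
move=> hX hY; split; first by apply: noise_measurableD; [case: hX|case: hY].
move=> n; under eq_fun do rewrite exprDn -sumEFin.
apply: integrable_sum => // i _.
under eq_fun do rewrite -mulr_natl EFinM.
by apply: integrableZl => //; exact: has_momentsXM.
Qed.

Lemma has_momentsZ c X : has_moments X -> has_moments (fun w => c * X w).
Proof. by apply: has_momentsM; exact: has_moments_cst. Qed.

Lemma has_momentsX X n : has_moments X -> has_moments (fun w => X w ^+ n).
Proof.
move=> hX; elim: n => [|n IHn]; first exact: has_moments_cst.
by under eq_fun do rewrite exprS; exact: has_momentsM.
Qed.

Lemma has_moments_sum (I : Type) (r : seq I) (p : pred I) (F : I -> T -> R) :
  (forall i, has_moments (F i)) ->
  has_moments (fun w => \sum_(i <- r | p i) F i w).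
Proof.
move=> hF; elim: r => [|i r IHr].
  by under eq_fun do rewrite big_nil; exact: has_moments_cst.
under eq_fun do rewrite big_cons; case: (p i) => //; exact: has_momentsD.
Qed.

Lemma has_moments_prod (I : Type) (r : seq I) (F : I -> T -> R) :
  (forall i, has_moments (F i)) ->
  has_moments (fun w => \prod_(i <- r) F i w).
Proof.
move=> hF; elim: r => [|i r IHr].
  by under eq_fun do rewrite big_nil; exact: has_moments_cst.
by under eq_fun do rewrite big_cons; exact: has_momentsM.
Qed.

Lemma has_moments_L2 X : has_moments X -> noise_L2 B X.
Proof.
move=> hX; split; first by case: hX.
rewrite unlock.
have /integrable_fin_num : P.-integrable setT (fun w => (X w ^+ 2)%:E) by case: hX.
by move=> /(_ measurableT); rewrite ltey_eq => ->.
Qed.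

Lemma meanE X : has_moments X -> 'E_P[X]%E = (mean X)%:E.
Proof.
move=> hX; rewrite /mean unlock fineK//.
by apply: integrable_fin_num => //; exact: integrable_has_moments.
Qed.

Lemma mean_cst c : mean (fun=> c) = c.
Proof. by rewrite /mean expectation_cst. Qed.

Lemma meanD X Y : has_moments X -> has_moments Y ->
  mean (fun w => X w + Y w) = mean X + mean Y.
Proof.
move=> hX hY; rewrite /mean !unlock -(@RintegralD _ _ _ P) //;
  exact: integrable_has_moments.
Qed.

Lemma meanZ c X : has_moments X -> mean (fun w => c * X w) = c * mean X.
Proof.
move=> hX; rewrite /mean !unlock -(@RintegralZl _ _ _ P) //;
  exact: integrable_has_moments.
Qed.

Lemma mean_sum (I : Type) (r : seq I) (p : pred I) (F : I -> T -> R) :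
  (forall i, has_moments (F i)) ->
  mean (fun w => \sum_(i <- r | p i) F i w) = \sum_(i <- r | p i) mean (F i).
Proof.
move=> hF; elim: r => [|i r IHr].
  by rewrite big_nil; under eq_fun do rewrite big_nil; exact: mean_cst.
rewrite big_cons; under eq_fun do rewrite big_cons; case: (p i) => //.
by rewrite meanD ?IHr//; exact: has_moments_sum.
Qed.

Lemma mean_ae X Y : has_moments X -> has_moments Y ->
  {ae P, forall w, X w = Y w} -> mean X = mean Y.
Proof.
move=> hX hY XY; rewrite /mean !unlock; congr fine.
apply: ae_eq_integral => //; try apply/measurable_EFinP; try exact: has_moments_meas.
by apply: filterS XY => w -> _.
Qed.

Hypothesis noiseB : white_noise dot B.

(** The recursion also holds for the Dirac mass at 0, with variance 0. *)
Lemma gaussian_moments (X : {RV P >-> R}) : centered_gaussian X -> exists v : R,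
  [/\ forall n, P.-integrable setT (fun w => (X w ^+ n)%:E)
    & forall n, (\int[P]_w (X w ^+ n.+1)%:E =
         (n%:R * v)%:E * \int[P]_w (X w ^+ n.-1)%:E)%E].
Proof.
case=> s [s0 Xs]; exists (s ^+ 2).
have mX n : measurable_fun setT (fun x : R => x ^+ n) by exact: exprn_measurable.
case: (eqVneq s 0) Xs => [->|sN0] Xs.
  have L n := @integral_law _ _ _ P _ _ X (dirac (0 : R)) _ Xs (mX n).
  have i0 n : (dirac (0 : R)).-integrable setT (EFin \o (fun x : R => x ^+ n)).
    apply/integrableP; split; first exact/measurable_EFinP.
    rewrite integral_dirac//; last by do 2 apply: measurableT_comp => //.
    by rewrite diracT mul1e ltry.
  split=> n; first by case: (L n (i0 n)).
  rewrite (proj2 (L n.+1 (i0 n.+1))) expr0n/= mulr0 mul0e.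
  rewrite integral_dirac//; last exact/measurable_EFinP.
  by rewrite expr0n /= mule0.
(* the normal law is a measure on the sigma-algebra generated by the half-open
   intervals, which has the same sets as the default one on R *)
pose nu : probability (measurableTypeR R) R := normal_prob 0 s.
have mX' : measurable_fun setT (X : T -> measurableTypeR R).
  by move=> _ A mA; apply: (@measurable_funP _ _ _ _ _ X measurableT A mA).
pose X' : {RV P >-> measurableTypeR R} :=
  HB.pack (X : T -> measurableTypeR R) (isMeasurableFun.Build _ _ _ _ _ mX').
have L n := @integral_law _ _ _ P _ _ X' nu _ Xs (mX n).
have i1 n := integrable_exprn_normal_pdf n sN0.
have i0 n := integrable_normal_prob sN0 (mX n) (i1 n).
split=> n; first by case: (L n (i0 n)).
rewrite (proj2 (L n.+1 (i0 n.+1))) (proj2 (L n.-1 (i0 n.-1))).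
by rewrite !integral_normal_prob// integral_exprS_normal_pdf.
Qed.

Lemma has_momentsB f : has_moments (B f).
Proof.
split; first exact: noise_measurableB.
by case: (gaussian_moments (wn_gaussian noiseB f)) => v [].
Qed.

(** The variance is identified by the case n = 1 of the recursion. *)
Lemma mean_exprB f n : mean (fun w => B f w ^+ n.+1) =
  n%:R * dot f f * mean (fun w => B f w ^+ n.-1).
Proof.
have [v [iB mB]] := gaussian_moments (wn_gaussian noiseB f).
have vE : dot f f = v.
  have := wn_covariance noiseB f f; rewrite unlock.
  rewrite (mB 1%N) mul1r.
  under eq_integral do rewrite expr0.
  by rewrite integral_cst// mul1e [X in (_ * X)%E]probability_setT mule1 => -[].
rewrite vE; apply: EFin_inj; rewrite EFinM -!meanE; try exact/has_momentsX/has_momentsB.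
by rewrite unlock mB.
Qed.

End moments.

(** * Gaussian integration by parts *)

Section dot_lemmas.
Context (R : realType) (H : completeNormedModType R) (dot : {dot H for idfun}).

Lemma dotC (u v : H) : dot u v = dot v u.
Proof. by rewrite hermC expr0 mul1r. Qed.

Lemma dotPl (t : R) (u v w : H) : dot (t *: u + v) w = t * dot u w + dot v w.
Proof. exact: linearPl. Qed.

Lemma dotPr (t : R) (u v w : H) : dot w (t *: u + v) = t * dot w u + dot w v.
Proof. by rewrite dotC dotPl 2!(dotC w). Qed.

End dot_lemmas.

Lemma horner_inj (R : realType) (p q : {poly R}) :
  (forall t, p.[t] = q.[t]) -> p = q.
Proof.
move=> pq; apply/eqP; rewrite -subr_eq0; apply/negPn/negP => pq0.
have := @max_poly_roots _ (p - q) [seq i%:R | i <- iota 0 (size (p - q))] pq0.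
rewrite size_map size_iota ltnn => h; apply/(elimF idP erefl)/h.
  by apply/allP => _ /mapP[i _ ->]; rewrite rootE hornerD hornerN pq subrr.
by rewrite map_inj_uniq ?iota_uniq// => i j /eqP; rewrite eqr_nat => /eqP.
Qed.

Section by_parts.
Context d (T : measurableType d) (R : realType) (P : probability T R).
Context (H : completeNormedModType R) (dot : {dot H for idfun}).
Variables (B : H -> {RV P >-> R}) (noiseB : white_noise dot B).

Local Notation mean := (mean P).
Local Notation hm := (has_moments B).

(** An identity between such means that is valid for all t can be differentiated
    at t = 0 by comparing the coefficients of t. *)
Lemma mean_pencil (X A C : T -> R) n : hm X -> hm A -> hm C ->
  exists Q : {poly R},
  [/\ forall t, Q.[t] = mean (fun w => X w * (A w + t * C w) ^+ n),
      Q`_0 = mean (fun w => X w * A w ^+ n)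
    & Q`_1 = n%:R * mean (fun w => X w * A w ^+ n.-1 * C w)].
Proof.
move=> hX hA hC.
pose F i w := X w * (A w ^+ (n - i) * C w ^+ i).
have hF i : hm (F i).
  by apply: has_momentsM => //; apply: has_momentsM; exact: has_momentsX.
exists (\poly_(i < n.+1) ('C(n, i)%:R * mean (F i))); split.
- move=> t; rewrite horner_poly.
  transitivity (mean (fun w => \sum_(i < n.+1) ('C(n, i)%:R * t ^+ i) * F i w)).
    rewrite (@mean_sum _ _ _ P _ B)// => [|i]; last exact: has_momentsZ.
    by apply: eq_bigr => i _; rewrite (@meanZ _ _ _ P _ B)// mulrAC.
  congr (mean _); apply/funext => w; rewrite exprDn mulr_sumr.
  apply: eq_bigr => i _; rewrite /F exprMn -mulr_natl; ring.
- rewrite coef_poly /= bin0 mul1r; congr (mean _); apply/funext => w.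
  by rewrite /F subn0 expr0 mulr1.
- rewrite coef_poly; case: n @F hF => [|n] F hF /=; first by rewrite mul0r.
  rewrite bin1; congr (_ * mean _); apply/funext => w.
  by rewrite /F subSS subn0 expr1 mulrA.
Qed.

Lemma mean_shift (X : T -> R) v u t n : hm X ->
  mean (fun w => X w * B (t *: u + v) w ^+ n) =
  mean (fun w => X w * (B v w + t * B u w) ^+ n).
Proof.
have hB := has_momentsB noiseB.
move=> hX; apply: (@mean_ae _ _ _ P _ B).
- by apply: has_momentsM => //; apply: has_momentsX.
- apply: has_momentsM => //; apply: has_momentsX; apply: has_momentsD => //.
  exact: has_momentsZ.
- by apply: filterS (wn_linear noiseB t u v) => w ->; rewrite addrC.
Qed.

(** The moment identity for B(u + t f), differentiated at t = 0, expresses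
    E[B(f) B(u)^n] by E[B(f) B(u)^(n-2)]; the claim follows by induction, using
    the moment identity for B(u) once more. *)
Lemma by_parts_expr f u n : mean (fun w => B f w * B u w ^+ n) =
  n%:R * dot f u * mean (fun w => B u w ^+ n.-1).
Proof.
have hB := has_momentsB noiseB.
have h1 : hm (fun=> 1) := has_moments_cst B 1.
(* Q and S are the two moments as polynomials in t, and the quadratic factor in
   QS is the variance of B (u + t f) *)
have D k : k.+1%:R * mean (fun w => B f w * B u w ^+ k) =
    k%:R * (2 * dot f u * mean (fun w => B u w ^+ k.-1) +
            dot u u * (k.-1%:R * mean (fun w => B f w * B u w ^+ k.-2))).
  have [Q [QE Q0 Q1]] := mean_pencil k.+1 h1 (hB u) (hB f).
  have [S [SE S0 S1]] := mean_pencil k.-1 h1 (hB u) (hB f).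
  have QS : Q = k%:R *: (((dot u u)%:P + (2 * dot f u) *: 'X + dot f f *: 'X^2) * S).
    apply: horner_inj => t; rewrite !hornerE QE SE -!mean_shift//.
    under eq_fun do rewrite mul1r.
    under [in RHS]eq_fun do rewrite mul1r.
    rewrite (mean_exprB noiseB) dotPl !dotPr (dotC dot u f) /=; ring.
  have := congr1 (fun p : {poly R} => p`_1) QS.
  rewrite Q1 coefZ coefM big_ord_recl big_ord1 /= !coefE /= S0 S1 => E.
  transitivity (k.+1%:R * mean (fun w : T => 1 * B u w ^+ k * B f w)).
    by congr (_ * mean _); apply/funext => w; ring.
  rewrite E; congr (_ * _).
  have -> : (fun w => 1 * B u w ^+ k.-1) = (fun w => B u w ^+ k.-1).
    by apply/funext => w; rewrite mul1r.
  have -> : (fun w => 1 * B u w ^+ k.-2 * B f w) = (fun w => B f w * B u w ^+ k.-2).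
    by apply/funext => w; ring.
  ring.
have nz k : k.+1%:R != 0 :> R by rewrite pnatr_eq0.
elim/ltn_ind: n => n IH; apply: (mulfI (nz n)); rewrite D.
case: n IH => [|[|n]] IH /=.
- by rewrite !mul0r mulr0.
- ring.
rewrite IH// (mean_exprB noiseB u n) /=; move: (mean _) => e; ring.
Qed.

Definition monomial (s : seq H) (w : T) : R := \prod_(u <- s) B u w.

(** The Malliavin derivative of the monomial, paired with f. *)
Fixpoint dmonomial (f : H) (s : seq H) (w : T) : R :=
  if s is u :: s' then dot f u * monomial s' w + B u w * dmonomial f s' w else 0.

Lemma monomial_cat s1 s2 w : monomial (s1 ++ s2) w = monomial s1 w * monomial s2 w.
Proof. by rewrite /monomial big_cat. Qed.

Lemma monomial_cons u s w : monomial (u :: s) w = B u w * monomial s w.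
Proof. by rewrite /monomial big_cons. Qed.

Lemma dmonomial_cat f s1 s2 w : dmonomial f (s1 ++ s2) w =
  dmonomial f s1 w * monomial s2 w + monomial s1 w * dmonomial f s2 w.
Proof.
elim: s1 => [|u s1 IH] /=; first by rewrite /monomial big_nil mul0r mul1r add0r.
by rewrite IH monomial_cat monomial_cons; ring.
Qed.

Lemma has_moments_monomial s : hm (monomial s).
Proof. by apply: has_moments_prod => u; exact: (has_momentsB noiseB). Qed.

Lemma has_moments_dmonomial f s : hm (dmonomial f s).
Proof.
have hB := has_momentsB noiseB.
elim: s => [|u s IH]; first exact: has_moments_cst.
exact: (has_momentsD (has_momentsZ _ (has_moments_monomial s)) (has_momentsM (hB u) IH)).
Qed.

(** Polarization, one factor at a time: in the identity with v + t u for v and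
    n + 1 for n, the coefficient of t moves a factor B u from the power to the
    monomial. The free exponent n is what makes the induction on s work. *)
Lemma by_parts_monomial_expr f s v n : mean (fun w => B f w * monomial s w * B v w ^+ n) =
  mean (fun w => dmonomial f s w * B v w ^+ n) +
  n%:R * dot f v * mean (fun w => monomial s w * B v w ^+ n.-1).
Proof.
have hB := has_momentsB noiseB.
elim: s v n => [|u s IH] v n.
  rewrite /=; under [X in _ = mean X + _]eq_fun do rewrite mul0r.
  rewrite mean_cst add0r /monomial.
  under [X in mean X = _]eq_fun do rewrite big_nil mulr1.
  under [X in _ = _ * mean X]eq_fun do rewrite big_nil mul1r.
  exact: by_parts_expr.
have hs := has_moments_monomial s; have hd := has_moments_dmonomial f s.
have hfs : hm (fun w => B f w * monomial s w) by exact: has_momentsM.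
have [Q [QE Q0 Q1]] := mean_pencil n.+1 hfs (hB v) (hB u).
have [S [SE S0 S1]] := mean_pencil n.+1 hd (hB v) (hB u).
have [V [VE V0 V1]] := mean_pencil n hs (hB v) (hB u).
have QS : Q = S + n.+1%:R *: (((dot f v)%:P + dot f u *: 'X) * V).
  apply: horner_inj => t; rewrite !hornerE QE SE VE -!mean_shift// IH dotPr /=.
  ring.
have := congr1 (fun p : {poly R} => p`_1) QS.
rewrite Q1 coefD coefZ coefM big_ord_recl big_ord1 /= !coefE /= S1 V0 V1 => E.
have nz : n.+1%:R != 0 :> R by rewrite pnatr_eq0.
apply: (mulfI nz).
transitivity (n.+1%:R * mean (fun w => B f w * monomial s w * B v w ^+ n * B u w)).
  by congr (_ * mean _); apply/funext => w; rewrite monomial_cons; ring.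
rewrite E.
have -> : mean (fun w => (dot f u * monomial s w + B u w * dmonomial f s w) * B v w ^+ n) =
   dot f u * mean (fun w => monomial s w * B v w ^+ n) +
   mean (fun w => dmonomial f s w * B v w ^+ n * B u w).
  have hX := has_momentsX n (hB v).
  rewrite -(@meanZ _ _ _ P _ B) -?(@meanD _ _ _ P _ B); first last.
  - by apply: has_momentsM.
  - by do 2 apply: has_momentsM => //.
  - by apply: has_momentsZ; apply: has_momentsM.
  by congr (mean _); apply/funext => w; ring.
have -> : mean (fun w => monomial (u :: s) w * B v w ^+ n.-1) =
   mean (fun w => monomial s w * B v w ^+ n.-1 * B u w).
  by congr (mean _); apply/funext => w; rewrite monomial_cons; ring.
ring.
Qed.

Lemma by_parts_monomial f s : mean (fun w => B f w * monomial s w) = mean (dmonomial f s).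
Proof.
have := by_parts_monomial_expr f s 0 0; rewrite !mul0r addr0.
under [in LHS]eq_fun do rewrite expr0 mulr1.
by under [X in _ = mean X -> _]eq_fun do rewrite expr0 mulr1.
Qed.

(** X is a polynomial in the noise and DX f its derivative along f. Relating X to
    a derivative computed from one of its expressions avoids having to prove
    that the derivative does not depend on the expression. *)
Definition gauss_poly (X : T -> R) (DX : H -> T -> R) :=
  exists L : seq (R * seq H),
    (forall w, X w = \sum_(p <- L) p.1 * monomial p.2 w) /\
    (forall f w, DX f w = \sum_(p <- L) p.1 * dmonomial f p.2 w).

Lemma gauss_poly_ext X DX X' DX' : X =1 X' -> DX =2 DX' ->
  gauss_poly X DX -> gauss_poly X' DX'.
Proof.
by move=> XE DE [L [LX LD]]; exists L; split=> [w|f w]; rewrite -?XE -?DE.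
Qed.

Lemma gauss_poly_has_moments X DX : gauss_poly X DX -> hm X.
Proof.
case=> L [LX _]; rewrite (_ : X = fun w => \sum_(p <- L) p.1 * monomial p.2 w).
  by apply: has_moments_sum => p; apply: has_momentsZ; exact: has_moments_monomial.
exact/funext.
Qed.

Lemma gauss_polyD X DX Y DY : gauss_poly X DX -> gauss_poly Y DY ->
  gauss_poly (fun w => X w + Y w) (fun f w => DX f w + DY f w).
Proof.
move=> [L [LX LD]] [M [MX MD]]; exists (L ++ M).
by split=> [w|f w]; rewrite big_cat ?LX ?LD ?MX ?MD.
Qed.

Lemma gauss_polyM X DX Y DY : gauss_poly X DX -> gauss_poly Y DY ->
  gauss_poly (fun w => X w * Y w) (fun f w => DX f w * Y w + X w * DY f w).
Proof.
move=> [L [LX LD]] [M [MX MD]].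
exists [seq (p.1 * q.1, p.2 ++ q.2) | p <- L, q <- M].
split=> [w|f w]; rewrite big_allpairs_dep /=.
  rewrite LX MX big_distrl; apply: eq_bigr => p _.
  by rewrite big_distrr; apply: eq_bigr => q _ /=; rewrite monomial_cat; ring.
rewrite LX MX LD MD !big_distrl -big_split; apply: eq_bigr => p _ /=.
rewrite !big_distrr -big_split; apply: eq_bigr => q _ /=.
by rewrite dmonomial_cat; ring.
Qed.

Lemma gauss_poly_cst c : gauss_poly (fun=> c) (fun _ _ => 0).
Proof.
exists [:: (c, [::])]; split=> [w|f w]; rewrite big_seq1 /=.
  by rewrite /monomial big_nil mulr1.
by rewrite mulr0.
Qed.

Lemma gauss_polyB u : gauss_poly (B u) (fun f _ => dot f u).
Proof.
exists [:: (1, [:: u])]; split=> [w|f w]; rewrite big_seq1 /= mul1r.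
  by rewrite /monomial big_seq1.
by rewrite /monomial big_nil mulr0 addr0 mulr1.
Qed.

Lemma gauss_poly_horner u (p : {poly R}) :
  gauss_poly (fun w => p.[B u w]) (fun f w => dot f u * (deriv p).[B u w]).
Proof.
elim/poly_ind: p => [|p c IH].
  apply: gauss_poly_ext (gauss_poly_cst 0) => [w|f w]; first by rewrite horner0.
  by rewrite deriv0 horner0 mulr0.
apply: gauss_poly_ext (gauss_polyD (gauss_polyM IH (gauss_polyB u)) (gauss_poly_cst c)).
  by move=> w; rewrite !hornerE.
by move=> f w; rewrite derivD derivC derivM derivX !hornerE /=; ring.
Qed.

Lemma gauss_poly_prod (I : eqType) (r : seq I) (u : I -> H) (p : I -> {poly R}) :
  uniq r -> gauss_poly (fun w => \prod_(i <- r) (p i).[B (u i) w])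
    (fun f w => \sum_(j <- r) dot f (u j) *
       \prod_(i <- r) (if i == j then deriv (p i) else p i).[B (u i) w]).
Proof.
elim: r => [_|k r IH /= /andP[kr ur]].
  apply: gauss_poly_ext (gauss_poly_cst 1) => [w|f w]; by rewrite big_nil.
apply: gauss_poly_ext (gauss_polyM (gauss_poly_horner (u k) (p k)) (IH ur)).
  by move=> w; rewrite big_cons.
move=> f w; rewrite !big_cons eqxx; congr (_ + _).
  rewrite -mulrA; congr (_ * (_ * _)); rewrite big_seq [RHS]big_seq.
  by apply: eq_bigr => i ir; case: eqP ir kr => // -> ->.
rewrite big_distrr big_seq [RHS]big_seq; apply: eq_bigr => j jr /=.
rewrite big_cons mulrCA; case: eqP jr kr => [-> ->//|_ _ _]; by [].
Qed.

(** Multiplication by B f is dual to differentiation along f. *)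
Lemma gaussian_by_parts X DX f : gauss_poly X DX ->
  mean (fun w => B f w * X w) = mean (DX f).
Proof.
case=> L [LX LD].
have hB := has_momentsB noiseB.
have hmo := has_moments_monomial; have hdm := has_moments_dmonomial.
have -> : DX f = fun w => \sum_(p <- L) p.1 * dmonomial f p.2 w by exact/funext.
have -> : (fun w => B f w * X w) =
    fun w => \sum_(p <- L) p.1 * (B f w * monomial p.2 w).
  apply/funext => w; rewrite LX big_distrr.
  by apply: eq_bigr => p _; rewrite /= mulrCA.
rewrite !(@mean_sum _ _ _ P _ B); first last.
- by move=> p; apply: has_momentsZ; apply: has_momentsM.
- by move=> p; apply: has_momentsZ.
apply: eq_bigr => p _; rewrite !(@meanZ _ _ _ P _ B)//; last exact: has_momentsM.
by rewrite by_parts_monomial.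
Qed.

End by_parts.

(** * Hermite polynomials *)

Section hermite_poly.
Variable R : realType.

Fixpoint hermite_poly (n : nat) : {poly R} :=
  if n is n'.+1 then 'X * hermite_poly n' - deriv (hermite_poly n') else 1.

Lemma is_derive_horner (p : {poly R}) (x : R) :
  is_derive x 1 (horner p) (deriv p).[x].
Proof.
elim/poly_ind: p => [|p c IH].
  rewrite deriv0 horner0 (_ : horner 0 = cst 0); first exact: is_derive_cst.
  by apply/funext => y; rewrite horner0.
rewrite (_ : horner _ = (horner p * (id : R -> R)) + cst c); last first.
  by apply/funext => y; rewrite !hornerE !fctE.
apply: is_derive_eq; rewrite derivD derivC derivM derivX !hornerE ?fctE /GRing.scale /=; ring.
Qed.

Lemma is_derive_gauss (x : R) :
  is_derive x 1 (fun s : R => expR (- (s ^+ 2 / 2))) (- x * expR (- (x ^+ 2 / 2))).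
Proof.
have -> : (fun s : R => expR (- (s ^+ 2 / 2))) = expR \o (- 2^-1 *: (id ^+ 2 : R -> R)).
  by apply/funext => y; rewrite !fctE /GRing.scale /=; congr expR; ring.
apply: is_derive_eq; rewrite !fctE /GRing.scale /= expr1 mulr1 mulrC.
by congr (_ * _); [field|congr expR; ring].
Qed.

Lemma derive1n_gauss n : derive1n n (fun s : R => expR (- (s ^+ 2 / 2))) =
  (fun t => (-1) ^+ n * ((hermite_poly n).[t] * expR (- (t ^+ 2 / 2)))).
Proof.
elim: n => [|n IH].
  by apply/funext => t /=; rewrite expr0 mul1r hornerC mul1r.
apply/funext => t; rewrite derive1nS IH derive1E.
set g := fun s : R => expR (- (s ^+ 2 / 2)).
have -> : (fun t : R => (-1) ^+ n * ((hermite_poly n).[t] * expR (- (t ^+ 2 / 2)))) =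
   (-1) ^+ n *: (horner (hermite_poly n) * g) by [].
have h1 := is_derive_horner (hermite_poly n) t.
have h2 := is_derive_gauss t.
have [_ ->] : is_derive t 1 ((-1) ^+ n *: (horner (hermite_poly n) * g))
   ((-1) ^+ n.+1 * ((hermite_poly n.+1).[t] * g t)).
  apply: is_derive_eq; rewrite [(-1) ^+ n.+1]exprS /= !hornerE /GRing.scale /= /g; ring.
by [].
Qed.

Lemma hermiteE n t : hermite n t = (hermite_poly n).[t].
Proof.
rewrite /hermite derive1n_gauss.
have e1 : expR (t ^+ 2 / 2) * expR (- (t ^+ 2 / 2)) = 1 :> R by rewrite -expRD subrr expR0.
have s1 : (-1) ^+ n * (-1) ^+ n = 1 :> R by rewrite -expr2 sqrr_sign.
rewrite mulrACA s1 mul1r mulrCA e1 mulr1 //.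
Qed.

Lemma deriv_hermite_poly n :
  deriv (hermite_poly n.+1) = n.+1%:R *: hermite_poly n.
Proof.
elim: n => [|n IH]; first by rewrite /= mulr1 derivB derivX derivC deriv0 subr0 scale1r.
rewrite [hermite_poly n.+2]/= -/(hermite_poly n.+1) derivB derivM derivX IH derivZ.
rewrite /= -!mul_polyC -[n.+2]addn1 natrD polyCD; ring.
Qed.

(** Normalized to have norm 1 for the standard normal law. *)
Definition nhermite n : {poly R} := (Num.sqrt n`!%:R)^-1 *: hermite_poly n.

Lemma sqrtr_fact_gt0 n : 0 < Num.sqrt n`!%:R :> R.
Proof. by rewrite sqrtr_gt0 ltr0n fact_gt0. Qed.

Lemma sqrtr_factS n : Num.sqrt n.+1`!%:R = Num.sqrt n.+1%:R * Num.sqrt n`!%:R :> R.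
Proof. by rewrite factS natrM sqrtrM// ler0n. Qed.

Lemma nhermite0 : nhermite 0 = 1.
Proof. by rewrite /nhermite fact0 sqrtr1 invr1 scale1r. Qed.

Lemma deriv_nhermite n : deriv (nhermite n) = Num.sqrt n%:R *: nhermite n.-1.
Proof.
case: n => [|n]; first by rewrite nhermite0 derivC sqrtr0 scale0r.
rewrite /nhermite derivZ deriv_hermite_poly !scalerA; congr (_ *: _) => /=.
have s0 : 0 < Num.sqrt n.+1%:R :> R by rewrite sqrtr_gt0 ltr0n.
have := sqr_sqrtr (ler0n R n.+1); have f0 := sqrtr_fact_gt0 n.
rewrite sqrtr_factS; move: (Num.sqrt n.+1%:R) s0 => s s0 <-.
field; rewrite !gt_eqF//.
Qed.

Lemma nhermiteS n :
  'X * nhermite n = Num.sqrt n.+1%:R *: nhermite n.+1 + Num.sqrt n%:R *: nhermite n.-1.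
Proof.
rewrite -deriv_nhermite /nhermite scalerA derivZ /= sqrtr_factS invfM.
have s0 : 0 < Num.sqrt n.+1%:R :> R by rewrite sqrtr_gt0 ltr0n.
rewrite mulrA divff ?gt_eqF// mul1r -scalerAr -scalerDr subrK//.
Qed.

Lemma mul_horner_nhermite n (x : R) : x * (nhermite n).[x] =
  Num.sqrt n.+1%:R * (nhermite n.+1).[x] + Num.sqrt n%:R * (nhermite n.-1).[x].
Proof.
have := congr1 (horner^~ x) (nhermiteS n).
by rewrite hornerM hornerX hornerD !hornerZ.
Qed.

End hermite_poly.

(** * The Hermite basis *)

Section multiindices.
Implicit Types (a b : multiindex) (k : nat).

Lemma mi_ext a b : (forall k, a k = b k) -> a = b.
Proof. by move=> ab; apply/fsfunP. Qed.

Lemma mi_addKunit a k : mi_sub (mi_add a (mi_unit k)) (mi_unit k) = a.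
Proof. by apply: mi_ext => i; rewrite mi_subE mi_addE addnK. Qed.

Lemma mi_subKunit a k : (0 < a k)%N ->
  mi_add (mi_sub a (mi_unit k)) (mi_unit k) = a.
Proof.
move=> ak; apply: mi_ext => i; rewrite mi_addE mi_subE subnK// mi_unitE.
by case: eqP => // ->.
Qed.

Lemma mi_add_unit_inj a k l :
  mi_add a (mi_unit k) = mi_add a (mi_unit l) -> k = l.
Proof.
move=> /(congr1 (fun c : multiindex => c k)).
rewrite !mi_addE !mi_unitE eqxx => /addnI; by case: eqP.
Qed.

Lemma mi_add_unit_neq a k l :
  mi_add (mi_add a (mi_unit k)) (mi_unit l) != a.
Proof.
apply/eqP => /(congr1 (fun c : multiindex => c k)) /eqP.
by rewrite !mi_addE !mi_unitE eqxx -addnA -{2}[a k]addn0 eqn_add2l.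
Qed.

(** By induction on |a|: a nonzero multi-index is a smaller one plus a unit. *)
Lemma multiindex_ind (Q : multiindex -> Prop) : Q [fsfun] ->
  (forall a k, Q a -> Q (mi_add a (mi_unit k))) -> forall a, Q a.
Proof.
move=> Q0 QS a; move: {2}(\sum_(k <- finsupp a) a k)%N (leqnn (\sum_(k <- finsupp a) a k)%N) => n.
elim: n a => [|n IH] a.
  rewrite leqn0 sum_nat_seq_eq0 => /allP a0.
  rewrite (_ : a = [fsfun])//; apply: mi_ext => k; rewrite fsfun0E.
  by apply/eqP; case: (boolP (k \in finsupp a)) => [/a0//|]; rewrite memNfinsupp.
case: (fset_0Vmem (finsupp a)) => [a0 _|[k ka]].
  by apply: IH; rewrite a0 big_nil.
have ak : (0 < a k)%N by rewrite lt0n -mem_finsupp.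
move=> an; rewrite -(mi_subKunit ak); apply/QS/IH.
rewrite -ltnS; apply: leq_trans an.
have sub : (finsupp (mi_sub a (mi_unit k)) `<=` finsupp a)%fset.
  apply/fsubsetP => i; rewrite !mem_finsupp mi_subE; apply: contra => /eqP ->.
  by rewrite sub0n.
rewrite (big_fset_incl _ sub) /=; last first.
  by move=> i _; rewrite mem_finsupp negbK => /eqP.
rewrite (big_fsetD1 k)//= [ltnRHS](big_fsetD1 k)//= mi_subE mi_unitE eqxx.
rewrite -addSn subn1 prednK// leq_add2l; apply: leq_sum => i _.
by rewrite mi_subE leq_subr.
Qed.

Lemma mi_fact_add_unit a k : mi_fact (mi_add a (mi_unit k)) = ((a k).+1 * mi_fact a)%N.
Proof.
rewrite /mi_fact; set c := mi_add a (mi_unit k).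
have ck : c k = (a k).+1 by rewrite /c mi_addE mi_unitE eqxx addn1.
have cE i : i != k -> c i = a i.
  by move=> /negbTE ik; rewrite /c mi_addE mi_unitE ik addn0.
have kc : k \in finsupp c by rewrite mem_finsupp ck.
have sub : (finsupp a `<=` finsupp c)%fset.
  by apply/fsubsetP => i; rewrite !mem_finsupp /c mi_addE addn_eq0 => /negbTE ->.
rewrite (big_fset_incl _ sub) /=; last first.
  by move=> i _; rewrite mem_finsupp negbK => /eqP ->.
rewrite (big_fsetD1 k)//= [in RHS](big_fsetD1 k)//= ck factS mulnA; congr (_ * _)%N.
by apply: eq_big_seq => i; rewrite !inE => /andP[ik _]; rewrite cE.
Qed.

End multiindices.

Section xi_lemmas.
Context d (T : measurableType d) (R : realType) (P : probability T R).
Context (H : completeNormedModType R) (dot : {dot H for idfun}).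
Variables (B : H -> {RV P >-> R}) (noiseB : white_noise dot B).
Variables (m : nat -> H) (mON : forall i j, dot (m i) (m j) = (i == j)%:R).
Implicit Types (a b : multiindex) (k : nat).

Local Notation mean := (mean P).
Local Notation xi := (xi B m).
Local Notation e_ := mi_unit.

(** The factors outside of the support are H_0 = 1; a product over a larger set S
    lets several multi-indices share their range. *)
Lemma xi_prod (S : {fset nat}) a w : (finsupp a `<=` S)%fset ->
  xi a w = \prod_(k <- S) (nhermite R (a k)).[B (m k) w].
Proof.
move=> aS; rewrite -(big_fset_incl _ aS) /=; last first.
  move=> k _; rewrite mem_finsupp negbK => /eqP ->.
  by rewrite nhermite0 hornerC.
by apply: eq_bigr => k _; rewrite /nhermite hornerZ hermiteE mulrC.
Qed.

Lemma xi0 w : xi [fsfun] w = 1.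
Proof. by rewrite /Defs.xi finsupp0 big_nil. Qed.

Lemma finsupp_sub_unit a k : (finsupp (mi_sub a (e_ k)) `<=` finsupp a)%fset.
Proof.
apply/fsubsetP => i; rewrite !mem_finsupp mi_subE; apply: contra => /eqP ->.
by rewrite sub0n.
Qed.

Lemma mul_xi k a w : B (m k) w * xi a w =
  Num.sqrt (a k).+1%:R * xi (mi_add a (e_ k)) w +
  Num.sqrt (a k)%:R * xi (mi_sub a (e_ k)) w.
Proof.
pose S := (k |` finsupp a)%fset.
have kS : k \in S by rewrite !inE eqxx.
have aS : (finsupp a `<=` S)%fset by exact: fsubsetUr.
have pS : (finsupp (mi_add a (e_ k)) `<=` S)%fset.
  apply/fsubsetP => i; rewrite !inE !mem_finsupp mi_addE mi_unitE.
  by case: (i == k) => //=; rewrite addn0.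
rewrite !(@xi_prod S)//; last exact: fsubset_trans (finsupp_sub_unit a k) aS.
rewrite !(big_fsetD1 k kS) /= mi_addE mi_subE mi_unitE eqxx addn1 subn1.
set p := \prod_(_ <- _) _.
have -> : \prod_(i <- (S `\ k)%fset) (nhermite R (mi_add a (e_ k) i)).[B (m i) w] = p.
  apply: eq_big_seq => i; rewrite !inE => /andP[/negbTE ik _].
  by rewrite mi_addE mi_unitE ik addn0.
have -> : \prod_(i <- (S `\ k)%fset) (nhermite R (mi_sub a (e_ k) i)).[B (m i) w] = p.
  apply: eq_big_seq => i; rewrite !inE => /andP[/negbTE ik _].
  by rewrite mi_subE mi_unitE ik subn0.
rewrite mulrA mul_horner_nhermite; ring.
Qed.

(** Since H_n' = n H_(n-1), differentiation lowers one entry of the multi-index.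
    At a k with a k = 0 the truncated a - e_k is a dummy, multiplied by 0. *)
Lemma gauss_poly_xi (S : {fset nat}) a : (finsupp a `<=` S)%fset ->
  gauss_poly dot B (xi a) (fun f w =>
    \sum_(k <- S) dot f (m k) * (Num.sqrt (a k)%:R * xi (mi_sub a (e_ k)) w)).
Proof.
move=> aS.
apply: gauss_poly_ext (gauss_poly_prod dot B m (nhermite R \o a) (fset_uniq S)).
  by move=> w; rewrite (xi_prod w aS).
move=> f w; apply: eq_big_seq => k kS; congr (_ * _).
rewrite (@xi_prod S); last exact: fsubset_trans (finsupp_sub_unit a k) aS.
rewrite !(big_fsetD1 k kS) /= eqxx deriv_nhermite hornerZ mulrA.
rewrite mi_subE mi_unitE eqxx subn1; congr (_ * _).
apply: eq_big_seq => i; rewrite !inE => /andP[/negbTE ik _].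
by rewrite mi_subE mi_unitE ik subn0.
Qed.

Lemma has_moments_xi a : has_moments B (xi a).
Proof. exact: gauss_poly_has_moments noiseB _ _ (gauss_poly_xi (fsubset_refl _)). Qed.

Lemma mean_mulB_xi f a b (S : {fset nat}) :
  (finsupp a `<=` S)%fset -> (finsupp b `<=` S)%fset ->
  mean (fun w => B f w * xi a w * xi b w) =
  \sum_(k <- S) dot f (m k) *
    (Num.sqrt (a k)%:R * mean (fun w => xi (mi_sub a (e_ k)) w * xi b w) +
     Num.sqrt (b k)%:R * mean (fun w => xi a w * xi (mi_sub b (e_ k)) w)).
Proof.
move=> aS bS.
have hxi c c' : has_moments B (fun w => xi c w * xi c' w).
  by apply: has_momentsM; exact: has_moments_xi.
have := gaussian_by_parts noiseB f (gauss_polyM (gauss_poly_xi aS) (gauss_poly_xi bS)).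
under [X in mean X = _]eq_fun do rewrite mulrA.
move=> ->; transitivity (mean (fun w => \sum_(k <- S) dot f (m k) *
    (Num.sqrt (a k)%:R * (xi (mi_sub a (e_ k)) w * xi b w) +
     Num.sqrt (b k)%:R * (xi a w * xi (mi_sub b (e_ k)) w)))).
  congr (mean _); apply/funext => w; rewrite big_distrl big_distrr -big_split.
  by apply: eq_bigr => k _ /=; ring.
have hs k : has_moments B (fun w =>
    Num.sqrt (a k)%:R * (xi (mi_sub a (e_ k)) w * xi b w) +
     Num.sqrt (b k)%:R * (xi a w * xi (mi_sub b (e_ k)) w)).
  by apply: has_momentsD; exact: has_momentsZ.
rewrite (@mean_sum _ _ _ P _ B); last by move=> k; apply: has_momentsZ.
apply: eq_bigr => k _; rewrite (@meanZ _ _ _ P _ B)//.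
by rewrite (@meanD _ _ _ P _ B)//; try exact: has_momentsZ; rewrite !(@meanZ _ _ _ P _ B).
Qed.

(** The creation and annihilation operators in the direction m_k are adjoint:
    multiplication by B (m k) is the sum of the two, and integration by parts of
    B (m k) xi_a xi_b differentiates both factors; the term in which xi_a is
    lowered occurs on both sides. *)
Lemma mean_xi_add_unit a b k :
  Num.sqrt (a k).+1%:R * mean (fun w => xi (mi_add a (e_ k)) w * xi b w) =
  Num.sqrt (b k)%:R * mean (fun w => xi a w * xi (mi_sub b (e_ k)) w).
Proof.
have hxi c c' : has_moments B (fun w => xi c w * xi c' w).
  by apply: has_momentsM; exact: has_moments_xi.
pose S := (k |` (finsupp a `|` finsupp b))%fset.
have kS : k \in S by rewrite !inE eqxx.
have aS : (finsupp a `<=` S)%fset by rewrite /S fsetUCA fsubsetUl.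
have bS : (finsupp b `<=` S)%fset by rewrite /S fsetUA fsubsetUr.
have := mean_mulB_xi (m k) aS bS.
rewrite (big_fsetD1 k kS) /= [X in _ = _ + X -> _]big1_seq ?addr0; last first.
  by move=> i; rewrite !inE => /andP[_ /andP[/negbTE ik _]]; rewrite mON eq_sym ik mul0r.
rewrite mON eqxx mul1r.
under [X in mean X = _ -> _]eq_fun do rewrite mul_xi mulrDl -2!mulrA.
rewrite (@meanD _ _ _ P _ B); try exact: has_momentsZ.
by rewrite !(@meanZ _ _ _ P _ B)// => E; lra.
Qed.

(** By adjointness, units are removed from a and b in parallel; the mean vanishes
    as soon as a unit of one is missing from the other, and E[xi_0 xi_0] = 1. *)
Lemma mean_xi_xi a b : mean (fun w => xi a w * xi b w) = (a == b)%:R.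
Proof.
have sq n : Num.sqrt n.+1%:R != 0 :> R by rewrite gt_eqF// sqrtr_gt0 ltr0n.
have zN c k : mi_add c (e_ k) != [fsfun].
  apply/eqP => /(congr1 (fun x : multiindex => x k)) /eqP.
  by rewrite fsfun0E mi_addE mi_unitE eqxx addn1.
elim/multiindex_ind: a b => [b|a k IH b].
  elim/multiindex_ind: b => [|b k _].
    rewrite eqxx (_ : (fun _ => _) = fun=> 1) ?mean_cst//.
    by apply/funext => w; rewrite !xi0 mulr1.
  rewrite eq_sym (negbTE (zN _ _)); apply: (mulfI (sq (b k))).
  under [X in _ * mean X = _]eq_fun do rewrite mulrC.
  by rewrite mean_xi_add_unit fsfun0E sqrtr0 mul0r mulr0.
apply: (mulfI (sq (a k))); rewrite mean_xi_add_unit IH.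
case: (posnP (b k)) => [bk|bk].
  rewrite bk sqrtr0 mul0r; case: eqP => [E|]; last by rewrite mulr0.
  by move: bk; rewrite -E mi_addE mi_unitE eqxx addn1.
case: (eqVneq a _) => [->|ab].
  by rewrite mi_subKunit// eqxx mi_subE mi_unitE eqxx subn1 prednK.
case: eqP => [E|]; last by rewrite !mulr0.
by rewrite -E mi_addKunit eqxx in ab.
Qed.

Lemma chaos_coefE X a : chaos_coef B m X a = mean (fun w => X w * xi a w).
Proof. by []. Qed.

(** Orthonormality turns each mean in the integration by parts formula into an
    indicator. Writing the conditions as a = b + e_k and b = a + e_k, and not as
    b = a - e_k and a = b - e_k, removes the truncated subtraction. *)
Lemma chaos_coef_mulB_xi f b a (S := (finsupp b `|` finsupp a)%fset) :
  chaos_coef B m (fun w => B f w * xi b w) a =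
  \sum_(k <- S) dot f (m k) *
    (Num.sqrt (a k)%:R * (a == mi_add b (e_ k))%:R +
     Num.sqrt (b k)%:R * (b == mi_add a (e_ k))%:R).
Proof.
have sub (c c' : multiindex) k : Num.sqrt (c k)%:R * (mi_sub c (e_ k) == c')%:R =
    Num.sqrt (c k)%:R * (c == mi_add c' (e_ k))%:R :> R.
  case: (posnP (c k)) => [->|ck]; first by rewrite sqrtr0 !mul0r.
  congr (_ * (nat_of_bool _)%:R); apply/eqP/eqP => [<-|->].
    by rewrite mi_subKunit.
  by rewrite mi_addKunit.
rewrite chaos_coefE (mean_mulB_xi f (S := S)) ?fsubsetUl ?fsubsetUr//.
apply: eq_bigr => k _; congr (_ * _); rewrite !mean_xi_xi addrC sub.
by rewrite [in X in X + _]eq_sym sub.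
Qed.

Lemma chaos_coef_mulB_xi_up f b k :
  chaos_coef B m (fun w => B f w * xi b w) (mi_add b (e_ k)) =
  Num.sqrt (b k).+1%:R * dot f (m k).
Proof.
rewrite chaos_coef_mulB_xi.
have kS : k \in (finsupp b `|` finsupp (mi_add b (e_ k)))%fset.
  by rewrite !inE !mem_finsupp mi_addE mi_unitE eqxx addn1 orbT.
rewrite (big_fsetD1 k kS) /= big1_seq ?addr0 => [|i].
  rewrite eqxx mi_addE mi_unitE eqxx addn1 mulr1 eq_sym.
  by rewrite (negbTE (mi_add_unit_neq _ _ _)) mulr0 addr0 mulrC.
rewrite !inE => /andP[_ /andP[ik _]].
rewrite eq_sym [_ == mi_add (mi_add _ _) _]eq_sym (negbTE (mi_add_unit_neq _ _ _)).
case: eqP => [/mi_add_unit_inj E|_]; last by rewrite !mulr0 addr0 mulr0.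
by rewrite E eqxx in ik.
Qed.

Lemma chaos_coef_mulB_xi_down f a k :
  chaos_coef B m (fun w => B f w * xi (mi_add a (e_ k)) w) a =
  Num.sqrt (a k).+1%:R * dot f (m k).
Proof.
rewrite -chaos_coef_mulB_xi_up !chaos_coefE; congr (mean _).
by apply/funext => w; ring.
Qed.

Lemma chaos_coef_mulB_xi_neq0 f b a :
  chaos_coef B m (fun w => B f w * xi b w) a != 0 ->
  exists k, a = mi_add b (e_ k) \/ b = mi_add a (e_ k).
Proof.
apply: contra_neqP => /forallNP h; rewrite chaos_coef_mulB_xi big1_seq// => k _.
case: eqP => [E|_]; first by case: (h k); left.
case: eqP => [E|_]; first by case: (h k); right.
by rewrite !mulr0 addr0 mulr0.
Qed.

End xi_lemmas.

(** * Wick products with a first-order factor *)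

(** Equality of formal sums ignores null terms, so it is enough to have a
    bijection between the indices of the nonzero ones. *)
Lemma fs_eq_reindex (V : nmodType) (F G : formal_sum V)
    (phi : fs_index G -> fs_index F) :
  (forall i, fs_term i != 0 -> fs_term (phi i) = fs_term i) ->
  (forall i j, fs_term i != 0 -> fs_term j != 0 -> phi i = phi j -> i = j) ->
  (forall j, fs_term j != 0 -> exists2 i, phi i = j & fs_term i != 0) ->
  fs_eq F G.
Proof.
move=> phiE phiI phiS x x0.
have -> : [set j | @fs_term V F j = x] = phi @` [set i | @fs_term V G i = x].
  apply/seteqP; split=> [j /= jx|_ [i /= ix <-]]; last by rewrite phiE ix.
  have [|i ij i0] := phiS j; first by rewrite jx.
  by exists i => //=; rewrite -phiE// ij.
by apply: inj_card_eq => i j; rewrite !inE /= => ix jx; apply: phiI; rewrite ?ix ?jx.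
Qed.

Section coefficients.
Context (R : realType) (H : completeNormedModType R) (dot : {dot H for idfun}).
Hypothesis dot_norm : hilbert_norm dot.
Variables (m : nat -> H) (mON : forall i j, dot (m i) (m j) = (i == j)%:R).

(** Bessel's inequality for a single vector: u - (u, m_k) m_k has a nonnegative
    norm. *)
Lemma ler_norm_dot u k : `|dot u (m k)| <= `|u|.
Proof.
rewrite -(@ler_pXn2r _ 2) ?nnegrE// -dot_norm real_normK ?num_real//.
set c := dot u (m k).
have : 0 <= dot (- c *: m k + u) (- c *: m k + u).
  by rewrite dot_norm exprn_ge0.
by rewrite !dotPl !dotPr mON eqxx (dotC dot (m k)) -/c mulr1; nra.
Qed.

Lemma dot_partial_sum (x : nat -> R) n k :
  dot (\sum_(0 <= i < n) x i *: m i) (m k) = if (k < n)%N then x k else 0.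
Proof.
elim: n => [|n IH]; first by rewrite big_nil linear0l.
rewrite big_nat_recr//= addrC dotPl mON IH ltnS.
case: (ltngtP k n) => [kn|kn|->]; rewrite ?eqxx ?mulr1 ?addr0//.
- by rewrite mulr0 add0r.
- by rewrite mulr0.
Qed.

(** The inner product with m k is continuous, and it equals x k on every partial
    sum that is long enough. *)
Lemma dot_series (x : nat -> R) (u : H) k :
  (fun n => \sum_(0 <= i < n) x i *: m i) @ \oo --> u -> dot u (m k) = x k.
Proof.
move=> xu; apply/eqP; rewrite -subr_eq0 -normr_le0; apply/ler_addgt0Pr => e e0.
rewrite add0r; move/cvgrPdist_lt : xu => /(_ e e0) [N _ xN].
have /ltW := xN (maxn N k.+1) (leq_maxl _ _); apply: le_trans.
apply: le_trans (ler_norm_dot _ k).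
have -> : u - \sum_(0 <= i < maxn N k.+1) x i *: m i =
    -1 *: \sum_(0 <= i < maxn N k.+1) x i *: m i + u.
  by rewrite scaleN1r addrC.
by rewrite dotPl dot_partial_sum leq_maxr mulN1r addrC.
Qed.

End coefficients.

Section wick_products.
Context d (T : measurableType d) (R : realType) (P : probability T R).
Context (H : completeNormedModType R) (dot : {dot H for idfun}).
Variables (B : H -> {RV P >-> R}) (noiseB : white_noise dot B).
Variables (m : nat -> H) (mON : forall i j, dot (m i) (m j) = (i == j)%:R).
Implicit Types (a b c : multiindex) (k : nat).

Local Notation xi := (xi B m).
Local Notation e_ := mi_unit.
Local Notation coef := (chaos_coef B m).

Lemma mi_add0 a : mi_add [fsfun] a = a.
Proof. by apply: mi_ext => k; rewrite mi_addE fsfun0E. Qed.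

Lemma mi_addC a b : mi_add a b = mi_add b a.
Proof. by apply: mi_ext => k; rewrite !mi_addE addnC. Qed.

Lemma mi_fact_unit k : mi_fact (e_ k) = 1%N.
Proof.
by rewrite -[e_ k]mi_add0 mi_fact_add_unit fsfun0E mul1n /mi_fact finsupp0 big_nil.
Qed.

Lemma mi_fact_gt0 a : (0 < mi_fact a)%N.
Proof. by rewrite /mi_fact prodn_gt0// => k; exact: fact_gt0. Qed.

Lemma chaos_coef_xi b c : coef (xi b) c = (b == c)%:R.
Proof. by rewrite chaos_coefE (mean_xi_xi noiseB mON). Qed.

Lemma chaos_coefB f a : coef (B f) a = coef (fun w => B f w * xi [fsfun] w) a.
Proof. by congr chaos_coef; apply/funext => w; rewrite xi0 mulr1. Qed.

Lemma chaos_coefB_unit f k : coef (B f) (e_ k) = dot f (m k).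
Proof.
rewrite chaos_coefB -{1}[e_ k]mi_add0 (chaos_coef_mulB_xi_up noiseB mON).
by rewrite fsfun0E sqrtr1 mul1r.
Qed.

Lemma chaos_coefB_neq0 f a : coef (B f) a != 0 -> exists k, a = e_ k.
Proof.
rewrite chaos_coefB => /(chaos_coef_mulB_xi_neq0 noiseB mON)[k [->|]].
  by exists k; rewrite mi_add0.
move=> /(congr1 (fun x : multiindex => x k)) /eqP.
by rewrite fsfun0E mi_addE mi_unitE eqxx addn1.
Qed.

(** The noise B f lives in the first chaos, so that only the pair (e_k, b) can
    contribute to the Wick product with xi_b. *)
Lemma wick_coef_term f b (p : multiindex * multiindex) :
  p != (p.1, b) \/ (forall k, p.1 <> e_ k) ->
  coef (B f) p.1 * coef (xi b) p.2 = 0.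
Proof.
move=> h; apply/eqP; rewrite mulf_eq0 chaos_coef_xi.
case: (eqVneq b p.2) => [bp|_]; last by rewrite eqxx orbT.
case: h => [|h]; first by rewrite bp -surjective_pairing eqxx.
rewrite oner_eq0 orbF; apply/negPn/negP => /chaos_coefB_neq0 [k]; exact: h.
Qed.

Lemma wick_coef_up f b k :
  wick_coef B m (B f) (xi b) (mi_add b (e_ k)) = Num.sqrt (b k).+1%:R * dot f (m k).
Proof.
rewrite /wick_coef -(fsbig_widen [set (e_ k, b)]); last 2 first.
- by move=> _ /= ->; rewrite mi_addC.
- move=> p /= [pE pN]; rewrite wick_coef_term ?mul0r//.
  case: (eqVneq p (p.1, b)) => [pb|]; [right => j pj|by left].
  apply: pN; rewrite pb pj; congr (_, _); congr mi_unit.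
  by apply: (@mi_add_unit_inj b); rewrite -pE pb pj mi_addC.
rewrite fsbig_set1 /= chaos_coefB_unit chaos_coef_xi eqxx mulr1 mulrC.
rewrite mi_fact_unit mul1n mi_fact_add_unit natrM mulfK//.
by rewrite pnatr_eq0 -lt0n mi_fact_gt0.
Qed.

Lemma wick_coef_neq0 f b c : wick_coef B m (B f) (xi b) c != 0 ->
  exists k, c = mi_add b (e_ k).
Proof.
apply: contra_neqP => /forallNP h; rewrite /wick_coef fsbig1// => p /= pE.
rewrite wick_coef_term ?mul0r//.
case: (eqVneq p (p.1, b)) => [pb|]; [right => j pj|by left].
by apply: (h j); rewrite -pE pb pj mi_addC.
Qed.

(** The product of B f and xi_b has components of index b + e_k, which are those
    of the Wick product, and finitely many of index b - e_k, which are
    subtracted. The Wick product is thus a polynomial in the noise,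
    hence square integrable. *)
Lemma is_wick_productB_xi f b :
  is_wick_product B m (B f) (xi b) (fun w => B f w * xi b w +
    \sum_(k <- finsupp b) - (dot f (m k) * Num.sqrt (b k)%:R) * xi (mi_sub b (e_ k)) w).
Proof.
have hxi := has_moments_xi noiseB m.
have h1 c : has_moments B (fun w => B f w * xi b w * xi c w).
  by apply: has_momentsM => //; apply: has_momentsM => //; exact: (has_momentsB noiseB).
have hs : has_moments B (fun w => \sum_(k <- finsupp b)
    - (dot f (m k) * Num.sqrt (b k)%:R) * xi (mi_sub b (e_ k)) w).
  by apply: has_moments_sum => k; exact: has_momentsZ.
split.
  apply: has_moments_L2; apply: has_momentsD => //.
  by apply: has_momentsM => //; exact: (has_momentsB noiseB).
move=> c; rewrite chaos_coefE; under [X in mean _ X]eq_fun do rewrite mulrDl.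
rewrite (@meanD _ _ _ P _ B)//; last exact: has_momentsM.
rewrite -(chaos_coefE B m (fun w => B f w * xi b w)).
have -> : mean P (fun w => (\sum_(k <- finsupp b)
    - (dot f (m k) * Num.sqrt (b k)%:R) * xi (mi_sub b (e_ k)) w) * xi c w) =
   - \sum_(k <- finsupp b) dot f (m k) * Num.sqrt (b k)%:R * (b == mi_add c (e_ k))%:R.
  transitivity (mean P (fun w => \sum_(k <- finsupp b)
      - (dot f (m k) * Num.sqrt (b k)%:R) * (xi (mi_sub b (e_ k)) w * xi c w))).
    congr (mean P _); apply/funext => w; rewrite big_distrl.
    by apply: eq_bigr => k _; rewrite mulrA.
  rewrite (@mean_sum _ _ _ P _ B); last first.
    by move=> k; apply: has_momentsZ; exact: has_momentsM.
  rewrite -sumrN; apply: eq_big_seq => k; rewrite mem_finsupp -lt0n => bk.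
  rewrite (@meanZ _ _ _ P _ B); last exact: has_momentsM.
  rewrite (mean_xi_xi noiseB mON) mulNr; congr (- (_ * (nat_of_bool _)%:R)).
  by apply/eqP/eqP => [<-|->]; rewrite ?mi_subKunit ?mi_addKunit.
case: (pselect (exists k, b = mi_add c (e_ k))) => [[k bE]|bN].
  have -> : wick_coef B m (B f) (xi b) c = 0.
    apply/eqP/negPn/negP => /wick_coef_neq0 [j cE].
    by have := mi_add_unit_neq c k j; rewrite -bE -cE eqxx.
  have -> : coef (fun w => B f w * xi b w) c = Num.sqrt (c k).+1%:R * dot f (m k).
    by rewrite bE (chaos_coef_mulB_xi_down noiseB mON).
  have kb : k \in finsupp b by rewrite mem_finsupp bE mi_addE mi_unitE eqxx addn1.
  rewrite (big_fsetD1 k kb) /= big1_seq ?addr0 => [|i].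
    rewrite [b == _](introT eqP bE) mulr1.
    by rewrite bE mi_addE mi_unitE eqxx addn1 mulrC subrr.
  rewrite !inE => /andP[_ /andP[ik _]]; case: eqP => [|_]; last by rewrite mulr0.
  by rewrite {1}bE => /mi_add_unit_inj E; rewrite E eqxx in ik.
rewrite big1 ?oppr0 ?addr0 => [|k _]; last first.
  by case: eqP => [E|_]; [case: bN; exists k|rewrite mulr0].
case: (pselect (exists k, c = mi_add b (e_ k))) => [[k ->]|cN].
  by rewrite wick_coef_up (chaos_coef_mulB_xi_up noiseB mON).
transitivity (0 : R); [|apply/esym]; apply/eqP/negPn/negP.
  move=> /(chaos_coef_mulB_xi_neq0 noiseB mON)[k [E|E]].
    by apply: cN; exists k.
  by apply: bN; exists k.
by move=> /wick_coef_neq0.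
Qed.

End wick_products.

(** * Chaos expansions of the stochastic integrals *)

Theorem theorem7 (R : realType)
    (d : measure_display) (T : measurableType d) (P : probability T R)
    (H : completeNormedModType R) (dot : {dot H for idfun})
    (dot_norm : hilbert_norm dot) (sepH : separable H)
    (B : H -> {RV P >-> R}) (noiseB : white_noise dot B)
    (m : nat -> H) (basism : orthonormal_basis dot m)
    (eta : T -> H) (adm_eta : admissible dot B eta)
    (etaA : multiindex -> H)
    (etaAE : forall a, is_expectation P dot (fun w => xi B m a w *: eta w) (etaA a))
    (etaAk : multiindex -> nat -> R)
    (etaAkE : forall a,
      (fun n => \sum_(0 <= k < n) etaAk a k *: m k) @ \oo --> etaA a) :
  ((exists U, ito_integral B m etaA U) /\
   forall U, ito_integral B m etaA U ->
     formal_chaos_expansion B m U (fun a =>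
       fs_series (fun k : nat =>
         fs_one (Num.sqrt (a k)%:R * etaAk (mi_sub a (mi_unit k)) k)))) /\
  formal_chaos_expansion B m (stratonovich_integral B m etaA) (fun a =>
    fs_series (fun k : nat =>
      fs_add
        (fs_one (Num.sqrt (a k)%:R * etaAk (mi_sub a (mi_unit k)) k))
        (fs_one (Num.sqrt (a k).+1%:R * etaAk (mi_add a (mi_unit k)) k)))).
Proof.
have [mON _] := basism.
have etaAkD a k : dot (etaA a) (m k) = etaAk a k.
  exact: (dot_series dot_norm mON k (etaAkE a)).
have posN0 (a : multiindex) k x : Num.sqrt (a k)%:R * x != 0 :> R -> (0 < a k)%N.
  by rewrite lt0n; apply: contra_neqN => /eqP ->; rewrite sqrtr0 mul0r.
have subS (a : multiindex) k : (0 < a k)%N -> (mi_sub a (mi_unit k) k).+1 = a k.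
  by move=> ak; rewrite mi_subE mi_unitE eqxx subn1 prednK.
split; first split.
- by eexists => b; exact: (is_wick_productB_xi noiseB mON).
- move=> U UE; split=> [b|a]; first by case: (UE b).
  have coefU b : chaos_coef B m (U b) a = wick_coef B m (B (etaA b)) (xi B m b) a.
    by case: (UE b).
  (* the k-th term is the contribution of the index b = a - e_k *)
  apply: (@fs_eq_reindex _ (fs_series (fun b => fs_one (chaos_coef B m (U b) a)))
     (fs_series (fun k => fs_one (Num.sqrt (a k)%:R * etaAk (mi_sub a (mi_unit k)) k)))
     (fun i => existT (fun=> unit) (mi_sub a (mi_unit (projT1 i))) tt)).
  + move=> [k []] /= k0; have ak := posN0 _ _ _ k0.
    rewrite coefU -{3}(mi_subKunit ak) (wick_coef_up noiseB mON) subS//.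
    by rewrite etaAkD.
  + move=> [k []] [l []] /= /posN0 ak /posN0 al /(congr1 (@projT1 _ _)) /= kl.
    suff -> : k = l by [].
    apply: (@mi_add_unit_inj (mi_sub a (mi_unit k))).
    by rewrite mi_subKunit// kl mi_subKunit.
  + move=> [b []] /=; rewrite coefU => /[dup] b0 /(wick_coef_neq0 noiseB mON)[k aE].
    exists (existT (fun=> unit) k tt) => /=; first by rewrite aE mi_addKunit.
    move: b0; rewrite aE (wick_coef_up noiseB mON) etaAkD mi_addKunit.
    by rewrite mi_addE mi_unitE eqxx addn1.
- split=> [b|a].
    apply: has_moments_L2; apply: has_momentsM; first exact: (has_momentsB noiseB).
    exact: (has_moments_xi noiseB).
  have up b k : chaos_coef B m (stratonovich_integral B m etaA b) (mi_add b (mi_unit k)) =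
      Num.sqrt (b k).+1%:R * etaAk b k.
    by rewrite /stratonovich_integral (chaos_coef_mulB_xi_up noiseB mON) etaAkD.
  have down k : chaos_coef B m (stratonovich_integral B m etaA (mi_add a (mi_unit k))) a =
      Num.sqrt (a k).+1%:R * etaAk (mi_add a (mi_unit k)) k.
    by rewrite /stratonovich_integral (chaos_coef_mulB_xi_down noiseB mON) etaAkD.
  (* the two halves of the k-th term are the contributions of b = a - e_k and
     b = a + e_k *)
  apply: (@fs_eq_reindex _ (fs_series (fun b => fs_one
        (chaos_coef B m (stratonovich_integral B m etaA b) a)))
     (fs_series (fun k => fs_add
        (fs_one (Num.sqrt (a k)%:R * etaAk (mi_sub a (mi_unit k)) k))
        (fs_one (Num.sqrt (a k).+1%:R * etaAk (mi_add a (mi_unit k)) k))))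
     (fun i => existT (fun=> unit) (match projT2 i with
        | inl _ => mi_sub a (mi_unit (projT1 i))
        | inr _ => mi_add a (mi_unit (projT1 i)) end) tt)).
  + move=> [k [[]|[]]] /= k0; last exact: down.
    have ak := posN0 _ _ _ k0.
    by rewrite -{2}(mi_subKunit ak) up subS.
  + have mixed k l : (0 < a k)%N -> mi_sub a (mi_unit k) = mi_add a (mi_unit l) -> False.
      move=> ak E; have := mi_add_unit_neq a l k.
      by rewrite -E mi_subKunit// eqxx.
    move=> [k [[]|[]]] [l [[]|[]]] /= i0 j0 /(congr1 (@projT1 _ _)) /= kl.
    * have ak := posN0 _ _ _ i0; have al := posN0 _ _ _ j0.
      suff -> : k = l by [].
      apply: (@mi_add_unit_inj (mi_sub a (mi_unit k))).
      by rewrite mi_subKunit// kl mi_subKunit.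
    * by case: (mixed k l (posN0 _ _ _ i0) kl).
    * by case: (mixed l k (posN0 _ _ _ j0) (esym kl)).
    * by rewrite (mi_add_unit_inj kl).
  + move=> [b []] /= => /[dup] b0 /(chaos_coef_mulB_xi_neq0 noiseB mON)[k [aE|bE]].
      exists (existT (fun=> (unit + unit)%type) k (inl tt)) => /=.
        by rewrite aE mi_addKunit.
      by move: b0; rewrite aE up mi_addKunit mi_addE mi_unitE eqxx addn1.
    exists (existT (fun=> (unit + unit)%type) k (inr tt)) => /=.
      by rewrite bE.
    by move: b0; rewrite bE down.
Qed.
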